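(* Let $(M,g)$ be a four-dimensional pseudo-Riemannian manifold of neutral signature $(-,-,+,+)$, and suppose that $(M,g,f)$ is a half conformally flat gradient $f$-almost Ricci soliton, i.e. $(M,g)$ is half conformally flat and there are smooth real-valued functions $f,\lambda$ on $M$ with $\mathrm{Ric}+f\,\mathrm{Hess} f=\lambda g$. If $\|\nabla f\|=0$ with $\nabla f\neq 0$ (everywhere), then $(M,g)$ is locally a Walker manifold, and its scalar curvature $r$ satisfies $r=4\lambda-2\frac{\Delta f}{f}$.
   Context: Gradient $f$-almost Ricci soliton: a pseudo-Riemannian manifold $(M^n,g)$ with smooth real-valued functions $f$ (potential function) and $\lambda$ (soliton function) such that $\mathrm{Ric}+f\,\mathrm{Hess} f=\lambda g$, where $\mathrm{Hess} f(X,Y)=XY(f)-(\nabla_XY)(f)$ and $\nabla$ is the Levi-Civita connection; $\Delta f$ is the trace of $\mathrm{Hess} f$ with respect to $g$ and $r$ is the trace of $\mathrm{Ric}$ with respect to $g$. Half conformally flat: for an oriented 4-manifold, the Hodge star $*$ on 2-forms satisfies $*^2=\mathrm{Id}$ in neutral signature, and the Weyl conformal tensor, viewed as an endomorphism $W$ of $\Lambda^2$, decomposes as $W=W^+\oplus W^-$ with $W^{\pm}=\frac12(W\pm *W)$. The metric is self-dual if $W^-=0$ and anti-self-dual if $W^+=0$; it is half conformally flat if it is self-dual or anti-self-dual. Orientations are chosen locally. $\|\nabla f\|=0$ means $g(\nabla f,\nabla f)=0$ identically. Walker manifold: a pseudo-Riemannian manifold admitting a null distribution $\mathcal{D}$ that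 is parallel, i.e. $g$ vanishes identically on $\mathcal{D}$ and $\nabla_XY$ is a section of $\mathcal{D}$ for every section $Y$ of $\mathcal{D}$ and every vector field $X$; in the present four-dimensional neutral-signature setting $\mathcal{D}$ is 2-dimensional. ''Locally'' means that every point has a neighborhood on which such a distribution exists. The formula for $r$ is understood at points where $f\neq0$. *)

(* Defs.v *)
From HB Require Import structures.
From mathcomp Require Import all_boot all_order all_algebra.
From mathcomp Require Import all_classical all_reals all_analysis.

Set Implicit Arguments.
Unset Strict Implicit.
Unset Printing Implicit Defensive.

Import Order.TTheory GRing.Theory Num.Theory.
Import numFieldNormedType.Exports.

Local Open Scope classical_set_scope.
Local Open Scope ring_scope.

(** Points and tangent vectors are row vectors; a vector field [X] has
    components [X x 0 i].  All functions are total, but only their values on the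
    open set under consideration matter. *)

Definition partial (R : realType) (i : 'I_4) (f : 'rV[R]_4 -> R) (x : 'rV[R]_4) : R :=
  'D_(delta_mx 0 i) f x.

Fixpoint Ck_on (R : realType) (k : nat) (U : set 'rV[R]_4) (f : 'rV[R]_4 -> R) : Prop :=
  (forall x, U x -> {for x, continuous f}) /\
  match k with
  | 0%N => True
  | k'.+1 => forall i : 'I_4,
      (forall x, U x -> derivable f x (delta_mx 0 i)) /\ Ck_on k' U (partial i f)
  end.

Definition smooth_on (R : realType) (U : set 'rV[R]_4) (f : 'rV[R]_4 -> R) : Prop :=
  forall k : nat, Ck_on k U f.

Definition smooth_vf (R : realType) (U : set 'rV[R]_4) (X : 'rV[R]_4 -> 'rV[R]_4) : Prop :=
  forall i : 'I_4, smooth_on U (fun x => X x 0 i).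

(** A second countable Hausdorff space with a smooth atlas.  [chart_inv c] is
    relevant only on [chart_img c], where it is the inverse of [chart_map c]. *)

Record manifold4 (R : realType) := Manifold4 {
  carrier :> topologicalType;
  chart : Type;
  chart_dom : chart -> set carrier;
  chart_map : chart -> carrier -> 'rV[R]_4;
  chart_inv : chart -> 'rV[R]_4 -> carrier;
  chart_img := fun c : chart => chart_map c @` chart_dom c;
  carrier_hausdorff : hausdorff_space carrier;
  carrier_second_countable : @second_countable carrier;
  chart_cover : forall p : carrier, exists c : chart, chart_dom c p;
  chart_dom_open : forall c : chart, open (chart_dom c);
  chart_img_open : forall c : chart, open (chart_img c);
  chart_mapK : forall (c : chart) (p : carrier),
    chart_dom c p -> chart_inv c (chart_map c p) = p;
  chart_map_continuous : forall (c : chart) (p : carrier),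
    chart_dom c p -> {for p, continuous (chart_map c)};
  chart_inv_continuous : forall (c : chart) (x : 'rV[R]_4),
    chart_img c x -> {for x, continuous (chart_inv c)};
  chart_transition : forall (c d : chart) (k : 'I_4),
    smooth_on (chart_map c @` (chart_dom c `&` chart_dom d))
              (fun x => chart_map d (chart_inv c x) 0 k)
}.

Definition in_chart (R : realType) (M : manifold4 R) (c : chart M) (f : M -> R) :
  'rV[R]_4 -> R := fun x => f (chart_inv c x).

Definition smooth_fun (R : realType) (M : manifold4 R) (f : M -> R) : Prop :=
  forall c : chart M, smooth_on (chart_img c) (in_chart c f).

(** Jacobian of the change of coordinates from [c] to [d]: row [i] holds the
    components in the chart [d] of the [i]-th coordinate field of [c]. *)
Definition transition_jacobian (R : realType) (M : manifold4 R) (c d : chart M)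
    (x : 'rV[R]_4) : 'M[R]_4 :=
  \matrix_(i, k) partial i (fun y => chart_map d (chart_inv c y) 0 k) x.

(** A pseudo-Riemannian metric, given by its Gram matrices in the coordinate
    frames of the charts. *)
Record pseudo_metric (R : realType) (M : manifold4 R) := PseudoMetric {
  gram :> chart M -> 'rV[R]_4 -> 'M[R]_4;
  gram_smooth : forall (c : chart M) (i j : 'I_4),
    smooth_on (chart_img c) (fun x => gram c x i j);
  gram_sym : forall (c : chart M) (x : 'rV[R]_4),
    chart_img c x -> (gram c x)^T = gram c x;
  gram_unit : forall (c : chart M) (x : 'rV[R]_4),
    chart_img c x -> gram c x \in unitmx;
  gram_transition : forall (c d : chart M) (p : M),
    chart_dom c p -> chart_dom d p ->
    let J := transition_jacobian c d (chart_map c p) in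
    gram c (chart_map c p) = J *m gram d (chart_map d p) *m J^T
}.

(** The rows of [P] are a pseudo-orthonormal basis of type (-,-,+,+). *)
Definition neutral_signature (R : realType) (M : manifold4 R) (g : pseudo_metric M) : Prop :=
  forall (c : chart M) (x : 'rV[R]_4), chart_img c x ->
  exists2 P : 'M[R]_4, P \in unitmx &
    P *m g c x *m P^T = diag_mx (\row_(i < 4) (if (i < 2)%N then -1 else 1)).

(** Below, [G : 'rV[R]_4 -> 'M[R]_4] is the Gram matrix of a metric in coordinates. *)

Definition coord_field (R : realType) (i : 'I_4) : 'rV[R]_4 -> 'rV[R]_4 :=
  fun _ => delta_mx 0 i.

Definition inner (R : realType) (G : 'M[R]_4) (u v : 'rV[R]_4) : R :=
  (u *m G *m v^T) 0 0.

Definition metric_trace (R : realType) (G T : 'M[R]_4) : R := \tr (invmx G *m T).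

Definition vf_apply (R : realType) (X : 'rV[R]_4 -> 'rV[R]_4) (f : 'rV[R]_4 -> R) :
  'rV[R]_4 -> R := fun x => \sum_i X x 0 i * partial i f x.

Definition lie_bracket (R : realType) (X Y : 'rV[R]_4 -> 'rV[R]_4) :
    'rV[R]_4 -> 'rV[R]_4 :=
  fun x => \row_k (vf_apply X (fun y => Y y 0 k) x - vf_apply Y (fun y => X y 0 k) x).

(** [christoffel G k i j] is Gamma^k_ij. *)
Definition christoffel (R : realType) (G : 'rV[R]_4 -> 'M[R]_4) (k i j : 'I_4)
    (x : 'rV[R]_4) : R :=
  2^-1 * \sum_l invmx (G x) k l *
    (partial i (fun y => G y j l) x + partial j (fun y => G y i l) x
     - partial l (fun y => G y i j) x).

(** The Levi-Civita connection: [levi_civita G X Y] is nabla_X Y. *)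
Definition levi_civita (R : realType) (G : 'rV[R]_4 -> 'M[R]_4)
    (X Y : 'rV[R]_4 -> 'rV[R]_4) : 'rV[R]_4 -> 'rV[R]_4 :=
  fun x => \row_k (vf_apply X (fun y => Y y 0 k) x
                   + \sum_i \sum_j christoffel G k i j x * X x 0 i * Y x 0 j).

(** R(X,Y)Z = nabla_X nabla_Y Z - nabla_Y nabla_X Z - nabla_[X,Y] Z *)
Definition curvature (R : realType) (G : 'rV[R]_4 -> 'M[R]_4)
    (X Y Z : 'rV[R]_4 -> 'rV[R]_4) : 'rV[R]_4 -> 'rV[R]_4 :=
  fun x => levi_civita G X (levi_civita G Y Z) x
           - levi_civita G Y (levi_civita G X Z) x
           - levi_civita G (lie_bracket X Y) Z x.

(** R_ijkl = g(R(d_i,d_j)d_k, d_l); on a round sphere R_ijji > 0. *)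
Definition riemann (R : realType) (G : 'rV[R]_4 -> 'M[R]_4) (x : 'rV[R]_4)
    (i j k l : 'I_4) : R :=
  inner (G x)
    (curvature G (coord_field i) (coord_field j) (coord_field k) x)
    (coord_field l x).

(** Ric(Y,Z) = tr (X |-> R(X,Y)Z), which is positive on round spheres. *)
Definition ricci (R : realType) (G : 'rV[R]_4 -> 'M[R]_4) (x : 'rV[R]_4) : 'M[R]_4 :=
  \matrix_(j, k) \sum_i
    curvature G (coord_field i) (coord_field j) (coord_field k) x 0 i.

Definition scalar_curvature (R : realType) (G : 'rV[R]_4 -> 'M[R]_4) (x : 'rV[R]_4) : R :=
  metric_trace (G x) (ricci G x).

Definition gradient (R : realType) (G : 'rV[R]_4 -> 'M[R]_4) (f : 'rV[R]_4 -> R)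
    (x : 'rV[R]_4) : 'rV[R]_4 :=
  \row_i \sum_j invmx (G x) i j * partial j f x.

(** Hess f(X,Y) = X(Y f) - (nabla_X Y) f *)
Definition hessian_vf (R : realType) (G : 'rV[R]_4 -> 'M[R]_4) (f : 'rV[R]_4 -> R)
    (X Y : 'rV[R]_4 -> 'rV[R]_4) (x : 'rV[R]_4) : R :=
  vf_apply X (vf_apply Y f) x - vf_apply (levi_civita G X Y) f x.

Definition hessian (R : realType) (G : 'rV[R]_4 -> 'M[R]_4) (f : 'rV[R]_4 -> R)
    (x : 'rV[R]_4) : 'M[R]_4 :=
  \matrix_(i, j) hessian_vf G f (coord_field i) (coord_field j) x.

Definition laplacian (R : realType) (G : 'rV[R]_4 -> 'M[R]_4) (f : 'rV[R]_4 -> R)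
    (x : 'rV[R]_4) : R :=
  metric_trace (G x) (hessian G f x).

(** Weyl tensor in dimension 4, with the index conventions of [riemann]. *)
Definition weyl (R : realType) (G : 'rV[R]_4 -> 'M[R]_4) (x : 'rV[R]_4)
    (i j k l : 'I_4) : R :=
  riemann G x i j k l
  - 2^-1 * (G x i l * ricci G x j k - G x i k * ricci G x j l
            + G x j k * ricci G x i l - G x j l * ricci G x i k)
  + scalar_curvature G x / 6%:R * (G x i l * G x j k - G x i k * G x j l).

(** Two-forms at a point are skew matrices [w i j = w(d_i,d_j)] *)

Definition two_form (R : realType) (w : 'M[R]_4) : Prop := w^T = - w.

(** w^ij = g^ia g^jb w_ab *)
Definition raise2 (R : realType) (G w : 'M[R]_4) : 'M[R]_4 :=
  invmx G *m w *m (invmx G)^T.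

(** The permutation symbol, with [levi_symbol 0 1 2 3 = 1]. *)
Definition levi_symbol (R : realType) (i j k l : 'I_4) : R :=
  \det (\matrix_(a < 4, b < 4) (tnth [tuple i; j; k; l] a == b)%:R : 'M[R]_4).

(** The Hodge star; the orientation is that of the coordinates if [o] is
    [false] and the opposite one if [o] is [true]. *)
Definition hodge_star (R : realType) (o : bool) (G w : 'M[R]_4) : 'M[R]_4 :=
  \matrix_(k, l) (2^-1 * \sum_i \sum_j
    raise2 G w i j * ((-1) ^+ o * Num.sqrt `|\det G| * levi_symbol R i j k l)).

(** W as an endomorphism of two-forms; the index order makes the analogous
    operator of a metric of constant curvature K equal to K Id. *)
Definition weyl_op (R : realType) (G : 'rV[R]_4 -> 'M[R]_4) (x : 'rV[R]_4)
    (w : 'M[R]_4) : 'M[R]_4 :=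
  \matrix_(i, j) (2^-1 * \sum_k \sum_l weyl G x i j l k * raise2 (G x) w k l).

Definition weyl_plus (R : realType) (o : bool) (G : 'rV[R]_4 -> 'M[R]_4)
    (x : 'rV[R]_4) (w : 'M[R]_4) : 'M[R]_4 :=
  2^-1 *: (weyl_op G x w + hodge_star o (G x) (weyl_op G x w)).

Definition weyl_minus (R : realType) (o : bool) (G : 'rV[R]_4 -> 'M[R]_4)
    (x : 'rV[R]_4) (w : 'M[R]_4) : 'M[R]_4 :=
  2^-1 *: (weyl_op G x w - hodge_star o (G x) (weyl_op G x w)).

Definition self_dual_on (R : realType) (o : bool) (V : set 'rV[R]_4)
    (G : 'rV[R]_4 -> 'M[R]_4) : Prop :=
  forall x, V x -> forall w, two_form w -> weyl_minus o G x w = 0.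

Definition anti_self_dual_on (R : realType) (o : bool) (V : set 'rV[R]_4)
    (G : 'rV[R]_4 -> 'M[R]_4) : Prop :=
  forall x, V x -> forall w, two_form w -> weyl_plus o G x w = 0.

(** A smooth distribution of 2-planes on [V]: [D x] is a subspace, represented as
    a row space, and is locally spanned by smooth vector fields. *)
Definition smooth_plane_distribution (R : realType) (V : set 'rV[R]_4)
    (D : 'rV[R]_4 -> 'M[R]_4) : Prop :=
  forall x, V x -> \rank (D x) = 2%N /\
    exists U : set 'rV[R]_4, exists X Y : 'rV[R]_4 -> 'rV[R]_4,
      [/\ open U, U x, U `<=` V, smooth_vf U X /\ smooth_vf U Y
        & forall y, U y -> (D y == col_mx (X y) (Y y))%MS].

Definition null_distribution (R : realType) (V : set 'rV[R]_4)
    (G D : 'rV[R]_4 -> 'M[R]_4) : Prop :=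
  forall x, V x -> forall u v : 'rV[R]_4,
    (u <= D x)%MS -> (v <= D x)%MS -> inner (G x) u v = 0.

Definition parallel_distribution (R : realType) (V : set 'rV[R]_4)
    (G D : 'rV[R]_4 -> 'M[R]_4) : Prop :=
  forall X Y : 'rV[R]_4 -> 'rV[R]_4,
    smooth_vf V X -> smooth_vf V Y -> (forall x, V x -> (Y x <= D x)%MS) ->
    forall x, V x -> (levi_civita G X Y x <= D x)%MS.

Definition walker_on (R : realType) (V : set 'rV[R]_4) (G : 'rV[R]_4 -> 'M[R]_4) : Prop :=
  exists D : 'rV[R]_4 -> 'M[R]_4,
    [/\ smooth_plane_distribution V D, null_distribution V G D
      & parallel_distribution V G D].

(** A tensorial condition on the manifold is imposed in every chart. *)

Definition f_almost_ricci_soliton (R : realType) (M : manifold4 R) (g : pseudo_metric M)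
    (f lam : M -> R) : Prop :=
  forall (c : chart M) (x : 'rV[R]_4), chart_img c x ->
    ricci (g c) x + in_chart c f x *: hessian (g c) (in_chart c f) x
    = in_chart c lam x *: g c x.

(** Orientations are chosen locally; [o] ranges over both of them. *)
Definition half_conformally_flat (R : realType) (M : manifold4 R)
    (g : pseudo_metric M) : Prop :=
  forall (c : chart M) (x : 'rV[R]_4), chart_img c x ->
  exists V : set 'rV[R]_4, exists o : bool,
    [/\ open V, V x, V `<=` chart_img c
      & self_dual_on o V (g c) \/ anti_self_dual_on o V (g c)].

Definition isotropic_gradient (R : realType) (M : manifold4 R) (g : pseudo_metric M)
    (f : M -> R) : Prop :=
  forall (c : chart M) (x : 'rV[R]_4), chart_img c x ->
    let N := gradient (g c) (in_chart c f) x in inner (g c x) N N = 0.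

Definition nowhere_zero_gradient (R : realType) (M : manifold4 R) (g : pseudo_metric M)
    (f : M -> R) : Prop :=
  forall (c : chart M) (x : 'rV[R]_4), chart_img c x ->
    gradient (g c) (in_chart c f) x != 0.

(** Every point has an open neighbourhood, contained in any prescribed chart
    domain around it and described in the coordinates of that chart, on which a
    parallel null distribution of 2-planes exists. *)
Definition locally_walker (R : realType) (M : manifold4 R) (g : pseudo_metric M) : Prop :=
  forall (c : chart M) (x : 'rV[R]_4), chart_img c x ->
  exists V : set 'rV[R]_4,
    [/\ open V, V x, V `<=` chart_img c & walker_on V (g c)].

(* Main.v *)
Require Import Defs.
From HB Require Import structures.
From mathcomp Require Import all_boot all_order all_algebra.
From mathcomp Require Import all_classical all_reals all_analysis.
From mathcomp Require Import ring lra.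

(* Write N for the gradient of f and h for its Hessian; since N is null, h N = 0.
   Half conformal flatness says that the Weyl tensor is orthogonal to one of the
   two bundles of bivectors B with *B = B or *B = -B; call it L.  It is parallel, and for
   sections J of L the form tr(R(X,Y) J) is expressed by the Schouten tensor
   alone.  The second Bianchi identity, the soliton equation and the Ricci
   identity for N then give an algebraic identity of 3-forms at each point,
     b /\ w = (1 + f^2/2) df /\ (h J + J h),   w = the 2-form of J in L,
   for some 1-form b.  Solved in a frame adapted to N, it yields
   h (J N) = 0 for all J in L, and tr h = 0.  Hence the null planes
   D = {J N : J in L} lie in the kernel of h, which makes D parallel; and
   tr h = 0 reduces both the trace of the soliton equation and the claimed
   formula to r = 4 lambda. *)

Set Implicit Arguments.
Unset Strict Implicit.
Unset Printing Implicit Defensive.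

Import Order.TTheory GRing.Theory Num.Theory.
Import numFieldNormedType.Exports.

Local Open Scope classical_set_scope.
Local Open Scope ring_scope.

(** * Smooth functions *)

(** Tracing the curvature against a section J of L removes the Weyl tensor before anything is
    differentiated. With the Schouten tensor written a g - (f/2) h, the traced form is 4 a w - f
    tau, where tau is the 2-form of h J + J h. Its exterior derivative explains the coefficient 1 +
    f^2/2: the 1 comes from df in f tau. The f^2/2 comes from f times the antisymmetrised derivative
    of h, which the Ricci identity turns into the curvature applied to N, and whose Schouten part
    carries another f/2. The same terms give b = 4 (da + a f df). Nothing is known about da, so b is
    an unknown to be eliminated: J runs over the three dimensions of L, each with four components of
    a 3-form, so there are twelve linear equations. Since 1 + f^2/2 > 0 everywhere, zeros of f cause
    no trouble. In neutral signature J^2 may be a positive, zero or negative scalar for J in L, and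
    J N can be a multiple of N. A J with negative square is therefore chosen at the point and
    extended to a local section, so that N and J N span D. *)

Section Calculus.
Context {R : realType}.
Implicit Types (U : set 'rV[R]_4) (f g : 'rV[R]_4 -> R) (i j : 'I_4) (k : nat).

Lemma near_eq_on U f g x : open U -> U x -> (forall y, U y -> f y = g y) ->
  {near x, f =1 g}.
Proof.
move=> Uo Ux fg; near=> y; apply: fg; near: y.
exact: open_nbhs_nbhs.
Unshelve. all: by end_near. Qed.

Lemma continuous_eq_on U f g x : open U -> U x -> (forall y, U y -> f y = g y) ->
  {for x, continuous f} -> {for x, continuous g}.
Proof.
move=> Uo Ux fg fc; have fgx := near_eq_on Uo Ux fg.
rewrite /prop_for /continuous_at -(fg x Ux).
by apply: cvg_trans fc; apply: (@near_eq_cvg _ _ (nbhs x)).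
Qed.

Lemma partial_eq_on U f g i x : open U -> U x -> (forall y, U y -> f y = g y) ->
  partial i f x = partial i g x.
Proof. by move=> Uo Ux fg; apply: (@near_eq_derive _ _ _ f g); exact: near_eq_on Uo Ux fg. Qed.

Lemma Ck_on_eq U k f g : open U -> (forall y, U y -> f y = g y) ->
  Ck_on k U f -> Ck_on k U g.
Proof.
move=> Uo; elim: k f g => [|k IH] f g fg /= [fc fD]; split => //.
- by move=> x Ux; exact: continuous_eq_on Uo Ux fg (fc x Ux).
- by move=> x Ux; exact: continuous_eq_on Uo Ux fg (fc x Ux).
- move=> i; have [fd fk] := fD i; split.
    move=> x Ux; apply: near_eq_derivable (fd x Ux).
    exact: near_eq_on Uo Ux fg.
  by apply: IH fk => y Uy; exact: partial_eq_on Uo Uy fg.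
Qed.

Lemma Ck_onW U k f : Ck_on k.+1 U f -> Ck_on k U f.
Proof.
elim: k f => [|k IH] f [fc fD]; split => //.
by move=> i; have [fd fk] := fD i; split => //; exact: IH.
Qed.

Lemma Ck_on_subset U V k f : V `<=` U -> Ck_on k U f -> Ck_on k V f.
Proof.
move=> VU; elim: k f => [|k IH] f [fc fD]; split => //; try by move=> x /VU; exact: fc.
move=> i; have [fd fk] := fD i; split; first by move=> x /VU; exact: fd.
exact: IH.
Qed.

Lemma partial_cst i (c : R) x : partial i (fun=> c) x = 0.
Proof. exact: derive_cst. Qed.

Lemma Ck_on_cst U k (c : R) : Ck_on k U (fun=> c).
Proof.
elim: k c => [|k IH] c; split => //; try by move=> x _; exact: cst_continuous.
move=> i; split; first by move=> x _; exact: derivable_cst.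
rewrite (_ : partial i _ = fun=> 0) //; apply/funext => x; exact: partial_cst.
Qed.

Lemma Ck_onD U k f g : open U -> Ck_on k U f -> Ck_on k U g ->
  Ck_on k U (fun x => f x + g x).
Proof.
move=> Uo; elim: k f g => [|k IH] f g [fc fD] [gc gD]; split => //.
- by move=> x Ux; apply: continuousD; [exact: fc|exact: gc].
- by move=> x Ux; apply: continuousD; [exact: fc|exact: gc].
- move=> i; have [fd fk] := fD i; have [gd gk] := gD i; split.
    by move=> x Ux; apply: derivableD; [exact: fd|exact: gd].
  apply: (@Ck_on_eq U k (fun x => partial i f x + partial i g x)) => //.
    by move=> x Ux; rewrite /partial deriveD //; [exact: fd|exact: gd].
  exact: IH.
Qed.

Lemma Ck_onM U k f g : open U -> Ck_on k U f -> Ck_on k U g ->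
  Ck_on k U (fun x => f x * g x).
Proof.
move=> Uo; elim: k f g => [|k IH] f g Hf Hg; move: (Hf) (Hg) => [fc fD] [gc gD]; split => //.
- by move=> x Ux; apply: continuousM; [exact: fc|exact: gc].
- by move=> x Ux; apply: continuousM; [exact: fc|exact: gc].
- move=> i; have [fd fk] := fD i; have [gd gk] := gD i; split.
    by move=> x Ux; apply: derivableM; [exact: fd|exact: gd].
  apply: (@Ck_on_eq U k (fun x => f x * partial i g x + g x * partial i f x)) => //.
    by move=> x Ux; rewrite /partial deriveM //; [exact: fd|exact: gd].
  by apply: Ck_onD => //; apply: IH => //; exact: Ck_onW.
Qed.

(** The derivative of 1/f involves 1/f itself only to one order less, so the induction on [k] runs
    with [f] fixed. [Ck_on_sqrt] follows the same pattern. *)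
Lemma Ck_onV U k f : open U -> (forall x, U x -> f x != 0) -> Ck_on k U f ->
  Ck_on k U (fun x => (f x)^-1).
Proof.
move=> Uo f0; elim: k => [|k IH] Hf; move: (Hf) => [fc fD]; split => //.
- by move=> x Ux; apply: continuousV; [exact: f0|exact: fc].
- by move=> x Ux; apply: continuousV; [exact: f0|exact: fc].
- move=> i; have [fd fk] := fD i; split.
    by move=> x Ux; apply: derivableV; [exact: f0|exact: fd].
  apply: (@Ck_on_eq U k (fun x => (- 1) * ((f x)^-1 * (f x)^-1) * partial i f x)) => //.
    move=> x Ux; rewrite /partial deriveV; [|exact: f0|exact: fd].
    by rewrite /GRing.scale /= mulN1r expr2 invfM.
  have Hi := IH (Ck_onW Hf).
  by do 3?[apply: Ck_onM => //]; exact: Ck_on_cst.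
Qed.

(** Restriction to the line through [x] in direction [v] makes this a one-variable chain rule, for
    which directional derivability of [f] is enough. *)
Lemma derive_sqrt_comp f x v : 0 < f x -> derivable f x v ->
  derivable (fun y => Num.sqrt (f y)) x v /\
  'D_v (fun y => Num.sqrt (f y)) x = (2 * Num.sqrt (f x))^-1 * 'D_v f x.
Proof.
move=> fx0 fd.
pose h : R -> R := fun s => f (s *: v + x).
have hd : derivable h 0 1 by apply/(derivable1P f x v).
have h0 : h 0 = f x by rewrite /h scale0r add0r.
have sd : derivable (Num.sqrt : R -> R) (h 0) 1.
  by rewrite h0; apply: ex_derive; exact: is_derive1_sqrt.
have dline (F : 'rV[R]_4 -> R) : 'D_v F x = derive1 (fun s : R => F (s *: v + x)) 0.
  rewrite derive1E /derive; set g1 := fun h => h^-1 *: _; set g2 := fun h => h^-1 *: _.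
  suff -> : g1 = g2 by [].
  by apply/funext => s; rewrite /g1 /g2 /= scale0r add0r addr0 [_%:A]mulr1.
split.
  apply/derivable1P/derivable1_diffP.
  apply: (@differentiable_comp _ _ _ _ h (Num.sqrt : R -> R)).
    exact/derivable1_diffP.
  exact/derivable1_diffP.
rewrite !dline -/h -(derive_sqrt fx0) -h0 -derive1E.
by rewrite -[RHS](derive1_comp hd sd).
Qed.

Lemma Ck_on_sqrt U k f : open U -> (forall x, U x -> 0 < f x) -> Ck_on k U f ->
  Ck_on k U (fun x => Num.sqrt (f x)).
Proof.
move=> Uo f0; have s0 x : U x -> 2 * Num.sqrt (f x) != 0.
  by move=> Ux; rewrite mulf_neq0 // gt_eqF // sqrtr_gt0 f0.
elim: k => [|k IH] Hf; move: (Hf) => [fc fD]; split => //.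
- by move=> x Ux; apply: continuous_comp; [exact: fc|exact: sqrt_continuous].
- by move=> x Ux; apply: continuous_comp; [exact: fc|exact: sqrt_continuous].
- move=> i; have [fd fk] := fD i; split.
    by move=> x Ux; have [] := derive_sqrt_comp (f0 x Ux) (fd x Ux).
  apply: (@Ck_on_eq U k (fun x => (2 * Num.sqrt (f x))^-1 * partial i f x)) => //.
    by move=> x Ux; rewrite /partial; have [_ ->] := derive_sqrt_comp (f0 x Ux) (fd x Ux).
  apply: Ck_onM => //; apply: Ck_onV => //.
  by apply: Ck_onM => //; [exact: Ck_on_cst|exact: IH (Ck_onW Hf)].
Qed.

End Calculus.

(** * Symmetry of mixed partial derivatives *)

Section Schwarz.
Context {R : realType}.
Implicit Types (U : set 'rV[R]_4) (f g : 'rV[R]_4 -> R) (i j : 'I_4).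

Lemma is_derive_line (F : 'rV[R]_4 -> R) (z v : 'rV[R]_4) (s : R) : derivable F (z + s *: v) v ->
  is_derive s 1 (fun t : R => F (z + t *: v)) ('D_v F (z + s *: v)).
Proof.
move=> Fd.
have E : (fun h : R => h^-1 *: (((fun t : R => F (z + t *: v)) \o shift s) (h *: 1)
            - F (z + s *: v))) =
         (fun h : R => h^-1 *: ((F \o shift (z + s *: v)) (h *: v) - F (z + s *: v))).
  apply/funext => h /=; congr (_ *: (F _ - _)).
  by rewrite [_%:A]mulr1 scalerDl addrCA addrC -addrA.
apply: DeriveDef; first by rewrite /derivable E.
by rewrite /derive E.
Qed.

(** The mean value theorem is used twice: on the [j]-increment of [f] as a function of the
    [i]-coordinate, then on [partial i f] along [j]. *)
Lemma second_difference f i j (x : 'rV[R]_4) (h : R) : 0 < h ->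
  (forall s t : R, 0 <= s <= h -> 0 <= t <= h ->
    let y := x + s *: delta_mx 0 i + t *: delta_mx 0 j in
    derivable f y (delta_mx 0 i) /\ derivable (partial i f) y (delta_mx 0 j)) ->
  exists s t : R, [/\ 0 <= s <= h, 0 <= t <= h &
   f (x + h *: delta_mx 0 i + h *: delta_mx 0 j) - f (x + h *: delta_mx 0 i)
     - f (x + h *: delta_mx 0 j) + f x =
   h ^+ 2 * partial j (partial i f) (x + s *: delta_mx 0 i + t *: delta_mx 0 j)].
Proof.
move=> h0 fD; set ei := delta_mx 0 i; set ej := delta_mx 0 j.
have h00 : 0 <= (0 : R) <= h by rewrite lexx ltW.
have hhh : 0 <= h <= h by rewrite lexx ltW.
pose phi s := f ((x + h *: ej) + s *: ei) - f (x + s *: ei).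
pose dphi s := partial i f ((x + h *: ej) + s *: ei) - partial i f (x + s *: ei).
have phid (s : R) : 0 <= s <= h -> is_derive s 1 phi (dphi s).
  move=> sh; apply: is_deriveB; apply: is_derive_line.
    by rewrite addrAC; have [] := fD s h sh hhh.
  by have [] := fD s 0 sh h00; rewrite scale0r addr0.
have memo (s : R) : s \in `]0, h[ -> 0 <= s <= h.
  by rewrite in_itv /= => /andP[/ltW -> /ltW ->].
have memc (s : R) : s \in `[0, h] -> 0 <= s <= h by rewrite in_itv.
have [|s /memo sh E1] := @MVT _ phi dphi 0 h h0 (fun s sh => phid s (memo s sh)).
  by apply: derivable_within_continuous => s /memc /phid [].
pose psi t := partial i f ((x + s *: ei) + t *: ej).
have psid (t : R) : 0 <= t <= h ->
    is_derive t 1 psi (partial j (partial i f) ((x + s *: ei) + t *: ej)).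
  by move=> th; apply: is_derive_line; have [] := fD s t sh th.
have [|t /memo th E2] := @MVT _ psi _ 0 h h0 (fun t th => psid t (memo t th)).
  by apply: derivable_within_continuous => t /memc /psid [].
exists s, t; split => //.
move: E1 E2; rewrite /phi /dphi /psi !scale0r !addr0 subr0 => E1 E2.
rewrite expr2 -mulrA [h * partial _ _ _]mulrC -E2 mulrC [x + s *: ei + _]addrAC -E1.
by rewrite [x + h *: ej + _]addrAC; ring.
Qed.

(** The second difference is symmetric in [i] and [j], so the two mixed partials agree at some pair
    of points near [x]. Their continuity at [x] bounds the difference there by any [e]. *)
Lemma partialC U f i j x : open U -> Ck_on 2 U f -> U x ->
  partial i (partial j f) x = partial j (partial i f) x.
Proof.
move=> Uo [_ f1] Ux; apply/eqP; rewrite -subr_eq0 -normr_eq0; apply/eqP/le_anti.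
rewrite normr_ge0 andbT; apply/ler_addgt0Pl => e e0; rewrite addr0.
have e20 : 0 < e / 2 by rewrite divr_gt0.
have ci := ((f1 i).2.2 j).2.1 x Ux; have cj := ((f1 j).2.2 i).2.1 x Ux.
have /nbhs_ballP[d /= d0 dU] : nbhs x (fun y => [/\ U y,
    `|partial j (partial i f) x - partial j (partial i f) y| < e / 2 &
    `|partial i (partial j f) x - partial i (partial j f) y| < e / 2]).
  have A1 : nbhs x U by exact: open_nbhs_nbhs.
  have A2 : nbhs x (fun y => `|partial j (partial i f) x - partial j (partial i f) y| < e / 2).
    by move/cvgrPdist_lt : ci; apply.
  have A3 : nbhs x (fun y => `|partial i (partial j f) x - partial i (partial j f) y| < e / 2).
    by move/cvgrPdist_lt : cj; apply.
  by apply: filterS3 A1 A2 A3.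
(* Two displacements of size at most [h] add up to at most [d / 2], so the whole square lies in the
   ball of radius [d]. *)
pose h := d / 4.
have h0 : 0 < h by rewrite divr_gt0.
have fin (a b c c' : R) : `|a - c| < e / 2 -> `|b - c'| < e / 2 -> c = c' -> `|b - a| <= e.
  move=> ac bc cc; rewrite -{}cc in bc; rewrite -(subrKA c) [e]splitr (le_trans (ler_normD _ _)) //.
  by rewrite lerD // ltW // distrC.
have aux (A B C D : R) : A - B - C + D = A - C - B + D by ring.
have box a b (s t : R) : 0 <= s <= h -> 0 <= t <= h ->
    ball x d (x + s *: delta_mx 0 a + t *: delta_mx 0 b).
  move=> /andP[s0 sh] /andP[t0 th]; split => // k l; rewrite !mxE /ball /=.
  rewrite -addrA opprD addrA subrr add0r normrN (le_lt_trans (ler_normD _ _)) //.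
  have B (u : R) (c : 'I_4) : 0 <= u -> u <= h -> `|u * ((k == 0) && (l == c))%:R| <= h.
    by move=> u0 uh; case: (_ && _); rewrite ?mulr1 ?mulr0 ?normr0 ?ger0_norm // ltW.
  have := lerD (B s a s0 sh) (B t b t0 th).
  by rewrite /h => /le_lt_trans; apply; lra.
have D a b (s t : R) : 0 <= s <= h -> 0 <= t <= h ->
    let y := x + s *: delta_mx 0 a + t *: delta_mx 0 b in
    derivable f y (delta_mx 0 a) /\ derivable (partial a f) y (delta_mx 0 b).
  move=> sh th /=; have [Uy _ _] := dU _ (box a b s t sh th).
  by split; [exact: (f1 a).1|exact: ((f1 a).2.2 b).1].
have [s [t [sh th E1]]] := second_difference h0 (D i j).
have [s' [t' [sh' th' E2]]] := second_difference h0 (D j i).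
have E : partial j (partial i f) (x + s *: delta_mx 0 i + t *: delta_mx 0 j) =
         partial i (partial j f) (x + s' *: delta_mx 0 j + t' *: delta_mx 0 i).
  apply: (@mulfI _ (h ^+ 2)); first by rewrite expf_neq0 // gt_eqF.
  apply: etrans (esym E1) (etrans _ E2).
  rewrite (addrAC x (h *: delta_mx 0 j)).
  exact: aux.
have [_ A _] := dU _ (box i j s t sh th).
have [_ _ B] := dU _ (box j i s' t' sh' th').
exact: fin A B E.
Qed.

End Schwarz.

Section Smooth.
Context {R : realType} (U : set 'rV[R]_4) (Uo : open U).
Implicit Types (f g : 'rV[R]_4 -> R) (i j : 'I_4).

Lemma smooth_eq f g : (forall y, U y -> f y = g y) -> smooth_on U f -> smooth_on U g.
Proof. by move=> fg fs k; exact: Ck_on_eq fg (fs k). Qed.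

Lemma smooth_cst (c : R) : smooth_on U (fun=> c).
Proof. by move=> k; exact: Ck_on_cst. Qed.

Lemma smoothD f g : smooth_on U f -> smooth_on U g -> smooth_on U (fun x => f x + g x).
Proof. by move=> fs gs k; exact: Ck_onD. Qed.

Lemma smoothM f g : smooth_on U f -> smooth_on U g -> smooth_on U (fun x => f x * g x).
Proof. by move=> fs gs k; exact: Ck_onM. Qed.

Lemma smoothN f : smooth_on U f -> smooth_on U (fun x => - f x).
Proof.
move=> fs; apply: (@smooth_eq (fun x => -1 * f x)); first by move=> y _; rewrite mulN1r.
by apply: smoothM => //; exact: smooth_cst.
Qed.

Lemma smoothB f g : smooth_on U f -> smooth_on U g -> smooth_on U (fun x => f x - g x).
Proof. by move=> fs gs; apply: smoothD => //; exact: smoothN. Qed.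

Lemma smoothV f : (forall x, U x -> f x != 0) -> smooth_on U f ->
  smooth_on U (fun x => (f x)^-1).
Proof. by move=> f0 fs k; exact: Ck_onV. Qed.

Lemma smooth_sqrt f : (forall x, U x -> 0 < f x) -> smooth_on U f ->
  smooth_on U (fun x => Num.sqrt (f x)).
Proof. by move=> f0 fs k; exact: Ck_on_sqrt. Qed.

Lemma smooth_sum (I : Type) (r : seq I) (P : pred I) (F : I -> 'rV[R]_4 -> R) :
  (forall j : I, P j -> smooth_on U (F j)) -> smooth_on U (fun x => \sum_(i <- r | P i) F i x).
Proof.
move=> Fs; elim: r => [|i r IH].
  by apply: (smooth_eq _ (smooth_cst 0)) => y _; rewrite big_nil.
case Pi : (P i); last by apply: (smooth_eq _ IH) => y _; rewrite big_cons Pi.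
by apply: (smooth_eq _ (smoothD (Fs i Pi) IH)) => y _; rewrite big_cons Pi.
Qed.

Lemma smooth_prod (I : Type) (r : seq I) (P : pred I) (F : I -> 'rV[R]_4 -> R) :
  (forall j : I, P j -> smooth_on U (F j)) -> smooth_on U (fun x => \prod_(i <- r | P i) F i x).
Proof.
move=> Fs; elim: r => [|i r IH].
  by apply: (smooth_eq _ (smooth_cst 1)) => y _; rewrite big_nil.
case Pi : (P i); last by apply: (smooth_eq _ IH) => y _; rewrite big_cons Pi.
by apply: (smooth_eq _ (smoothM (Fs i Pi) IH)) => y _; rewrite big_cons Pi.
Qed.

Lemma smooth_partial i f : smooth_on U f -> smooth_on U (partial i f).
Proof. by move=> fs k; have [_ /(_ i) []] := fs k.+1. Qed.

Lemma smooth_derivable i f x : smooth_on U f -> U x -> derivable f x (delta_mx 0 i).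
Proof. by move=> fs Ux; have [_ /(_ i) [+ _]] := fs 1%N; apply. Qed.

Lemma smooth_continuous f x : smooth_on U f -> U x -> {for x, continuous f}.
Proof. by move=> fs Ux; have [+ _] := fs 0%N; apply. Qed.

Lemma partialD i f g x : smooth_on U f -> smooth_on U g -> U x ->
  partial i (fun y => f y + g y) x = partial i f x + partial i g x.
Proof. by move=> fs gs Ux; apply: deriveD; exact: smooth_derivable. Qed.

Lemma partialM i f g x : smooth_on U f -> smooth_on U g -> U x ->
  partial i (fun y => f y * g y) x = partial i f x * g x + f x * partial i g x.
Proof.
move=> fs gs Ux; rewrite addrC [partial i f x * _]mulrC.
by apply: deriveM; exact: smooth_derivable.
Qed.

Lemma partialN i f x : smooth_on U f -> U x ->
  partial i (fun y => - f y) x = - partial i f x.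
Proof. by move=> fs Ux; apply: deriveN; exact: smooth_derivable. Qed.

Lemma partialB i f g x : smooth_on U f -> smooth_on U g -> U x ->
  partial i (fun y => f y - g y) x = partial i f x - partial i g x.
Proof. by move=> fs gs Ux; rewrite partialD ?partialN //; exact: smoothN. Qed.

Lemma partial_sum i (I : Type) (r : seq I) (P : pred I) (F : I -> 'rV[R]_4 -> R) x :
  (forall j : I, P j -> smooth_on U (F j)) -> U x ->
  partial i (fun y => \sum_(j <- r | P j) F j y) x = \sum_(j <- r | P j) partial i (F j) x.
Proof.
move=> Fs Ux; elim: r => [|j r IH].
  rewrite big_nil -[RHS](partial_cst i 0 x); apply: partial_eq_on Uo Ux _ => y _.
  by rewrite big_nil.
have Hs := smooth_sum r Fs.
rewrite big_cons; case Pj : (P j).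
  rewrite -IH -partialD //; last exact: Fs.
  by apply: partial_eq_on Uo Ux _ => y _; rewrite big_cons Pj.
by rewrite -IH; apply: partial_eq_on Uo Ux _ => y _; rewrite big_cons Pj.
Qed.

Lemma smooth_partialC i j f x : smooth_on U f -> U x ->
  partial i (partial j f) x = partial j (partial i f) x.
Proof. by move=> fs; apply: partialC => //; exact: fs. Qed.

End Smooth.

Lemma smooth_subset {R : realType} (U V : set 'rV[R]_4) f :
  V `<=` U -> smooth_on U f -> smooth_on V f.
Proof. by move=> VU fs k; exact: Ck_on_subset VU (fs k). Qed.

(* Locked, since unification would otherwise unfold it down to limits. *)
HB.lock Definition dmx {R : realType} {m n : nat} (i : 'I_4) (A : 'rV[R]_4 -> 'M[R]_(m, n))
    (x : 'rV[R]_4) : 'M[R]_(m, n) :=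
  \matrix_(a, b) partial i (fun y => A y a b) x.

Lemma dmxE {R : realType} m n i (A : 'rV[R]_4 -> 'M[R]_(m, n)) x a b :
  dmx i A x a b = partial i (fun y => A y a b) x.
Proof. by rewrite dmx.unlock mxE. Qed.

(** * Differential calculus of matrix-valued functions *)

Section SmoothMatrix.
Context {R : realType} (U : set 'rV[R]_4) (Uo : open U).
Implicit Types (f g : 'rV[R]_4 -> R) (i j : 'I_4).

Definition smooth_mx m n (A : 'rV[R]_4 -> 'M[R]_(m, n)) :=
  forall a b, smooth_on U (fun x => A x a b).

Lemma smooth_mx_eq m n (A B : 'rV[R]_4 -> 'M[R]_(m, n)) :
  (forall y, U y -> A y = B y) -> smooth_mx A -> smooth_mx B.
Proof. by move=> AB As a b; apply: (smooth_eq Uo _ (As a b)) => y /AB ->. Qed.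

Lemma smooth_mx_cst m n (C : 'M[R]_(m, n)) : smooth_mx (fun=> C).
Proof. by move=> a b; exact: smooth_cst. Qed.

Lemma smooth_mxD m n (A B : 'rV[R]_4 -> 'M[R]_(m, n)) :
  smooth_mx A -> smooth_mx B -> smooth_mx (fun x => A x + B x).
Proof.
move=> As Bs a b; apply: (smooth_eq Uo _ (smoothD Uo (As a b) (Bs a b))) => y _.
by rewrite mxE.
Qed.

Lemma smooth_mxN m n (A : 'rV[R]_4 -> 'M[R]_(m, n)) :
  smooth_mx A -> smooth_mx (fun x => - A x).
Proof.
by move=> As a b; apply: (smooth_eq Uo _ (smoothN Uo (As a b))) => y _; rewrite mxE.
Qed.

Lemma smooth_mxB m n (A B : 'rV[R]_4 -> 'M[R]_(m, n)) :
  smooth_mx A -> smooth_mx B -> smooth_mx (fun x => A x - B x).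
Proof. by move=> As Bs; apply: smooth_mxD => //; exact: smooth_mxN. Qed.

Lemma smooth_mxM m n p (A : 'rV[R]_4 -> 'M[R]_(m, n)) (B : 'rV[R]_4 -> 'M[R]_(n, p)) :
  smooth_mx A -> smooth_mx B -> smooth_mx (fun x => A x *m B x).
Proof.
move=> As Bs a b; apply: (@smooth_eq _ _ Uo (fun x => \sum_c A x a c * B x c b)).
  by move=> y _; rewrite mxE.
by apply: smooth_sum => // c _; exact: smoothM.
Qed.

Lemma smooth_mxZ m n f (A : 'rV[R]_4 -> 'M[R]_(m, n)) :
  smooth_on U f -> smooth_mx A -> smooth_mx (fun x => f x *: A x).
Proof.
move=> fs As a b; apply: (smooth_eq Uo _ (smoothM Uo fs (As a b))) => y _.
by rewrite mxE.
Qed.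

Lemma smooth_mx_tr m n (A : 'rV[R]_4 -> 'M[R]_(m, n)) :
  smooth_mx A -> smooth_mx (fun x => (A x)^T).
Proof. by move=> As a b; apply: (smooth_eq Uo _ (As b a)) => y _; rewrite mxE. Qed.

Lemma smooth_trace n (A : 'rV[R]_4 -> 'M[R]_n) :
  smooth_mx A -> smooth_on U (fun x => \tr (A x)).
Proof. by move=> As; apply: smooth_sum. Qed.

Lemma smooth_det n (A : 'rV[R]_4 -> 'M[R]_n) :
  smooth_mx A -> smooth_on U (fun x => \det (A x)).
Proof.
move=> As; apply: smooth_sum => // s _; apply: smoothM => //; first exact: smooth_cst.
exact: smooth_prod.
Qed.

Lemma smooth_inv n (A : 'rV[R]_4 -> 'M[R]_n) :
  (forall x, U x -> A x \in unitmx) -> smooth_mx A -> smooth_mx (fun x => invmx (A x)).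
Proof.
move=> Au As; apply: (@smooth_mx_eq _ _ (fun x => (\det (A x))^-1 *: \adj (A x))).
  by move=> y Uy; rewrite /invmx Au.
apply: smooth_mxZ.
  apply: smoothV => // [x /Au|]; last exact: smooth_det.
  by rewrite unitmxE unitfE.
move=> a b; apply: (@smooth_eq _ _ Uo (fun y => (-1) ^+ (b + a) * \det (row' b (col' a (A y))))).
  by move=> y _; rewrite mxE.
apply: smoothM => //; first exact: smooth_cst.
apply: smooth_det => c d.
by apply: (smooth_eq Uo _ (As (lift b c) (lift a d))) => y _; rewrite !mxE.
Qed.

Lemma smooth_dmx m n i (A : 'rV[R]_4 -> 'M[R]_(m, n)) :
  smooth_mx A -> smooth_mx (dmx i A).
Proof.
move=> As a b; apply: (smooth_eq Uo _ (smooth_partial i (As a b))) => y _.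
by rewrite dmxE.
Qed.

Lemma dmx_eq m n i (A B : 'rV[R]_4 -> 'M[R]_(m, n)) x :
  (forall y, U y -> A y = B y) -> U x -> dmx i A x = dmx i B x.
Proof.
by move=> AB Ux; apply/matrixP => a b; rewrite !dmxE; apply: partial_eq_on Uo Ux _ => y /AB ->.
Qed.

Lemma dmx_cst m n i (C : 'M[R]_(m, n)) x : dmx i (fun=> C) x = 0.
Proof. by apply/matrixP => a b; rewrite dmxE partial_cst mxE. Qed.

Lemma dmxD m n i (A B : 'rV[R]_4 -> 'M[R]_(m, n)) x :
  smooth_mx A -> smooth_mx B -> U x ->
  dmx i (fun y => A y + B y) x = dmx i A x + dmx i B x.
Proof.
move=> As Bs Ux; apply/matrixP => a b; rewrite mxE !dmxE -(partialD i (As a b) (Bs a b)) //.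
by apply: partial_eq_on Uo Ux _ => y _; rewrite mxE.
Qed.

Lemma dmxN m n i (A : 'rV[R]_4 -> 'M[R]_(m, n)) x :
  smooth_mx A -> U x -> dmx i (fun y => - A y) x = - dmx i A x.
Proof.
move=> As Ux; apply/matrixP => a b; rewrite mxE !dmxE -(partialN i (As a b)) //.
by apply: partial_eq_on Uo Ux _ => y _; rewrite mxE.
Qed.

Lemma dmxB m n i (A B : 'rV[R]_4 -> 'M[R]_(m, n)) x :
  smooth_mx A -> smooth_mx B -> U x ->
  dmx i (fun y => A y - B y) x = dmx i A x - dmx i B x.
Proof. by move=> As Bs Ux; rewrite dmxD ?dmxN //; exact: smooth_mxN. Qed.

Lemma dmxM m n p i (A : 'rV[R]_4 -> 'M[R]_(m, n)) (B : 'rV[R]_4 -> 'M[R]_(n, p)) x :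
  smooth_mx A -> smooth_mx B -> U x ->
  dmx i (fun y => A y *m B y) x = dmx i A x *m B x + A x *m dmx i B x.
Proof.
move=> As Bs Ux; apply/matrixP => a b; rewrite dmxE !mxE -big_split /=.
rewrite (@partial_eq_on _ U _ (fun y => \sum_c A y a c * B y c b)) //; last first.
  by move=> y _; rewrite mxE.
rewrite (partial_sum Uo) //; last by move=> c _; exact: smoothM.
by apply: eq_bigr => c _; rewrite (@partialM _ U) // !dmxE.
Qed.

Lemma dmxZ m n i f (A : 'rV[R]_4 -> 'M[R]_(m, n)) x :
  smooth_on U f -> smooth_mx A -> U x ->
  dmx i (fun y => f y *: A y) x = partial i f x *: A x + f x *: dmx i A x.
Proof.
move=> fs As Ux; apply/matrixP => a b; rewrite dmxE !mxE !dmxE -(partialM i fs (As a b)) //.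
by apply: partial_eq_on Uo Ux _ => y _; rewrite mxE.
Qed.

Lemma dmx_tr m n i (A : 'rV[R]_4 -> 'M[R]_(m, n)) x :
  dmx i (fun y => (A y)^T) x = (dmx i A x)^T.
Proof.
by apply/matrixP => a b; rewrite ?mxE !dmxE ?mxE; congr partial; apply/funext => y; rewrite mxE.
Qed.

Lemma dmx_row m n i (A : 'rV[R]_4 -> 'M[R]_(m, n)) k x :
  dmx i (fun y => row k (A y)) x = row k (dmx i A x).
Proof.
by apply/matrixP => a b; rewrite ?mxE !dmxE ?mxE; congr partial; apply/funext => y; rewrite mxE.
Qed.

Lemma dmxC m n i j (A : 'rV[R]_4 -> 'M[R]_(m, n)) x :
  smooth_mx A -> U x -> dmx i (dmx j A) x = dmx j (dmx i A) x.
Proof.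
move=> As Ux; apply/matrixP => a b; rewrite !dmxE.
have E k : (fun y => dmx k A y a b) = partial k (fun y => A y a b).
  by apply/funext => y; rewrite dmxE.
by rewrite (E i) (E j); exact: (smooth_partialC Uo i j (As a b) Ux).
Qed.

Lemma partial_trace n i (A : 'rV[R]_4 -> 'M[R]_n) x :
  smooth_mx A -> U x -> partial i (fun y => \tr (A y)) x = \tr (dmx i A x).
Proof.
move=> As Ux; rewrite /mxtrace (partial_sum Uo) //.
by apply: eq_bigr => a _; rewrite dmxE.
Qed.

End SmoothMatrix.

Lemma smooth_mx_subset {R : realType} (U V : set 'rV[R]_4) m n (A : 'rV[R]_4 -> 'M[R]_(m, n)) :
  V `<=` U -> smooth_mx U A -> smooth_mx V A.
Proof. by move=> VU As a b; exact: smooth_subset VU (As a b). Qed.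

(** * Connection and curvature *)

Lemma addmxE (V : nmodType) m n (A B : 'M[V]_(m, n)) a b : (A + B) a b = A a b + B a b.
Proof. by rewrite mxE. Qed.
Lemma oppmxE (V : zmodType) m n (A : 'M[V]_(m, n)) a b : (- A) a b = - A a b.
Proof. by rewrite mxE. Qed.
Lemma scalemxE (V : pzRingType) m n c (A : 'M[V]_(m, n)) a b : (c *: A) a b = c * A a b.
Proof. by rewrite mxE. Qed.
Lemma zeromxE (V : nmodType) m n a b : (0 : 'M[V]_(m, n)) a b = 0.
Proof. by rewrite mxE. Qed.

(* These fix the structure instances inferred for products, transposes and rows,
   so that [mxlin] identifies equal summands syntactically. *)
Definition rmulmx (R : realType) m n p (A : 'M[R]_(m, n)) (B : 'M[R]_(n, p)) : 'M[R]_(m, p) :=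
  A *m B.

Definition rtrmx (R : realType) m n (A : 'M[R]_(m, n)) : 'M[R]_(n, m) := A^T.
Definition rrow (R : realType) m n i (A : 'M[R]_(m, n)) : 'rV[R]_n := row i A.

(** Every atomic summand of a linear matrix identity becomes a variable, after which [mxlin]
    compares entries with [ring]. Products therefore have to be expanded and associated alike
    beforehand. *)
Ltac mxgen t :=
  lazymatch t with
  | (?a + ?b)%R => mxgen a; mxgen b
  | (- ?a)%R => mxgen a
  | (_ *: ?a)%R => mxgen a
  | 0%R => idtac
  | _ => first [is_var t | generalize t; intro]
  end.

Ltac mxlin :=
  repeat match goal with |- context [@mulmx ?S ?m ?n ?p ?A ?B] =>
    change (@mulmx S m n p A B) with (rmulmx A B) end;
  repeat match goal with |- context [@trmx ?S ?m ?n ?A] =>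
    change (@trmx S m n A) with (rtrmx A) end;
  repeat match goal with |- context [@row ?S ?m ?n ?k ?A] =>
    change (@row S m n k A) with (rrow k A) end;
  repeat match goal with |- context [fun y => ?f y] => change (fun y => f y) with f end;
  lazymatch goal with |- ?a = ?b => mxgen a; mxgen b end;
  apply/matrixP => ? ?; rewrite ?(addmxE, oppmxE, scalemxE, zeromxE); ring.

(* Row [j] holds the components of nabla_i d_j, so that matrices act on row vectors. *)
HB.lock Definition conn_mx {R : realType} (G : 'rV[R]_4 -> 'M[R]_4) (i : 'I_4)
    (x : 'rV[R]_4) : 'M[R]_4 :=
  \matrix_(j, k) christoffel G k i j x.

(* The endomorphism [Z |-> Z *m curv_mx G i j x] is R(d_i,d_j). *)
HB.lock Definition curv_mx {R : realType} (G : 'rV[R]_4 -> 'M[R]_4) (i j : 'I_4)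
    (x : 'rV[R]_4) : 'M[R]_4 :=
  dmx i (conn_mx G j) x - dmx j (conn_mx G i) x
  + conn_mx G j x *m conn_mx G i x - conn_mx G i x *m conn_mx G j x.

Section Connection.
Context {R : realType}.
Implicit Types (G : 'rV[R]_4 -> 'M[R]_4) (X Y : 'rV[R]_4 -> 'rV[R]_4) (i j k : 'I_4).

(** These are the Christoffel symbols of the first kind, that is [conn_mx] with its upper index
    lowered. *)
Definition christoffel1 G i (x : 'rV[R]_4) : 'M[R]_4 :=
  \matrix_(j, l) (2^-1 * (dmx i G x j l + dmx j G x i l - dmx l G x i j)).

Definition cov G i Y (x : 'rV[R]_4) : 'rV[R]_4 := dmx i Y x + Y x *m conn_mx G i x.

Lemma conn_entry G i x j k : conn_mx G i x j k = christoffel G k i j x.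
Proof. by rewrite conn_mx.unlock mxE. Qed.

Lemma curv_mxE G i j x : curv_mx G i j x =
  dmx i (conn_mx G j) x - dmx j (conn_mx G i) x
  + conn_mx G j x *m conn_mx G i x - conn_mx G i x *m conn_mx G j x.
Proof. by rewrite curv_mx.unlock. Qed.

Lemma conn_mxE G i x : conn_mx G i x = christoffel1 G i x *m (invmx (G x))^T.
Proof.
apply/matrixP => j k; rewrite conn_entry [RHS]mxE /christoffel mulr_sumr; apply: eq_bigr => l _.
by rewrite [X in _ = X * _]mxE [X in _ = _ * X]mxE -!dmxE mulrCA mulrC.
Qed.

Lemma vf_apply_coord i (f : 'rV[R]_4 -> R) : vf_apply (coord_field i) f = partial i f.
Proof.
apply/funext => x; rewrite /vf_apply (bigD1 i) //= big1 ?addr0 => [|j ji].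
  by rewrite /coord_field mxE !eqxx mul1r.
by rewrite /coord_field mxE (negbTE ji) andbF mul0r.
Qed.

Lemma levi_civitaE G X Y x : levi_civita G X Y x = \sum_i X x 0 i *: cov G i Y x.
Proof.
apply/rowP => k; rewrite mxE summxE /vf_apply -big_split; apply: eq_bigr => i _ /=.
rewrite !mxE dmxE mulrDr mulr_sumr; congr (_ + _); apply: eq_bigr => j _.
by rewrite conn_entry; ring.
Qed.

Lemma levi_civita_coordE G i Y : levi_civita G (coord_field i) Y = cov G i Y.
Proof.
apply/funext => x; rewrite levi_civitaE (bigD1 i) //= big1 ?addr0 => [|j ji].
  by rewrite /coord_field mxE !eqxx scale1r.
by rewrite /coord_field mxE (negbTE ji) andbF scale0r.
Qed.

Lemma cov_coord G i j : cov G i (coord_field j) = fun x => row j (conn_mx G i x).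
Proof. by apply/funext => x; rewrite /cov dmx_cst add0r -rowE. Qed.

Lemma curvatureE G i j k x :
  curvature G (coord_field i) (coord_field j) (coord_field k) x = row k (curv_mx G i j x).
Proof.
have E0 : levi_civita G (lie_bracket (coord_field i) (coord_field j)) (coord_field k) x = 0.
  rewrite levi_civitaE big1 // => l _; rewrite mxE !vf_apply_coord.
  by rewrite !partial_cst subrr scale0r.
rewrite /curvature E0 subr0 !levi_civita_coordE !cov_coord /cov.
rewrite (dmx_row _ (conn_mx G i)) (dmx_row _ (conn_mx G j)) curv_mxE.
rewrite [RHS]raddfB /= [in RHS]raddfD /= [in RHS]raddfB /= !row_mul.
by mxlin.
Qed.

Lemma riemannE G x i j k l : riemann G x i j k l = (curv_mx G i j x *m G x) k l.
Proof.
by rewrite /riemann /inner curvatureE -row_mul /coord_field trmx_delta -colE !mxE.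
Qed.

Lemma ricciE G x j k : ricci G x j k = \sum_i curv_mx G i j x k i.
Proof. by rewrite mxE; apply: eq_bigr => i _; rewrite curvatureE mxE. Qed.

Lemma gradientE G f x : gradient G f x = (\row_j partial j f x) *m (invmx (G x))^T.
Proof. by apply/rowP => i; rewrite !mxE; apply: eq_bigr => j _; rewrite !mxE mulrC. Qed.

Lemma hessian_entry G f x i j :
  hessian G f x i j = partial i (partial j f) x - ((\row_k partial k f x) *m (conn_mx G i x)^T) 0 j.
Proof.
rewrite mxE /hessian_vf !vf_apply_coord levi_civita_coordE cov_coord; congr (_ - _).
by rewrite mxE; apply: eq_bigr => k _; rewrite !mxE conn_entry mulrC.
Qed.

Lemma curv_mxN G i j x : curv_mx G i j x = - curv_mx G j i x.
Proof. by rewrite !curv_mxE; mxlin. Qed.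

End Connection.

(** * Symmetries of the Levi-Civita connection and of its curvature, in matrix form *)

Section Metric.
Context {R : realType} (U : set 'rV[R]_4) (Uo : open U) (G : 'rV[R]_4 -> 'M[R]_4).
Hypotheses (Gs : smooth_mx U G) (GT : forall x, U x -> (G x)^T = G x)
  (Gu : forall x, U x -> G x \in unitmx).
Implicit Types (i j k l : 'I_4).
Local Notation Gam := (conn_mx G).
Local Notation Rm := (curv_mx G).

Lemma invmxT x : U x -> (invmx (G x))^T = invmx (G x).
Proof. by move=> Ux; rewrite trmx_inv GT. Qed.

Lemma smooth_christoffel1 i : smooth_mx U (christoffel1 G i).
Proof.
move=> a b.
apply: (@smooth_eq _ _ Uo (fun x => 2^-1 * (dmx i G x a b + dmx a G x i b - dmx b G x i a))).
  by move=> y _; rewrite [RHS]mxE.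
have D p q r : smooth_on U (fun x => dmx p G x q r) by exact: smooth_dmx.
exact: smoothM (smooth_cst _ _) (smoothB Uo (smoothD Uo (D _ _ _) (D _ _ _)) (D _ _ _)).
Qed.

Lemma smooth_conn i : smooth_mx U (Gam i).
Proof.
apply: (@smooth_mx_eq _ _ Uo _ _ (fun x => christoffel1 G i x *m (invmx (G x))^T)).
  by move=> y _; rewrite conn_mxE.
apply: smooth_mxM => //; first exact: smooth_christoffel1.
by apply: smooth_mx_tr => //; exact: smooth_inv.
Qed.

Lemma smooth_curv i j : smooth_mx U (Rm i j).
Proof.
have S := smooth_conn.
apply: (@smooth_mx_eq _ _ Uo _ _ (fun x => dmx i (Gam j) x - dmx j (Gam i) x + Gam j x *m Gam i x
  - Gam i x *m Gam j x)).
  by move=> y _; rewrite curv_mxE.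
apply: smooth_mxB => //; last exact: smooth_mxM.
apply: smooth_mxD => //; last exact: smooth_mxM.
by apply: smooth_mxB => //; exact: smooth_dmx.
Qed.

Lemma conn_lower i x : U x -> Gam i x *m G x = christoffel1 G i x.
Proof. by move=> Ux; rewrite conn_mxE invmxT // mulmxKV // Gu. Qed.

Lemma dmxG_sym i x : U x -> (dmx i G x)^T = dmx i G x.
Proof. by move=> Ux; rewrite -dmx_tr; apply: dmx_eq Ux. Qed.

(** This is metric compatibility: adding the first-kind symbols to their transpose cancels all
    derivatives but the one along [i]. *)
Lemma dmxG i x : U x -> dmx i G x = Gam i x *m G x + G x *m (Gam i x)^T.
Proof.
move=> Ux; have -> : G x *m (Gam i x)^T = (Gam i x *m G x)^T by rewrite trmx_mul GT.
rewrite conn_lower //; apply/matrixP => j l; rewrite addmxE [(_^T) _ _]mxE.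
rewrite [christoffel1 _ _ _ j l]mxE [christoffel1 _ _ _ l j]mxE.
have E a b c : dmx a G x c b = dmx a G x b c by rewrite -[in LHS](dmxG_sym a Ux) [LHS]mxE.
rewrite (E i j l); move: (dmx i G x j l) (dmx j G x i l) (dmx l G x i j) => p q r.
by field.
Qed.

(** This is the absence of torsion; it rests on the symmetry of [G] alone. *)
Lemma conn_sym i j x : U x -> row j (Gam i x) = row i (Gam j x).
Proof.
move=> Ux; rewrite !conn_mxE !row_mul; congr (_ *m _); apply/rowP => l.
rewrite [LHS]mxE [in LHS]mxE [RHS]mxE [in RHS]mxE.
have -> : dmx l G x j i = dmx l G x i j by rewrite -[in LHS](dmxG_sym l Ux) [LHS]mxE.
by rewrite [dmx j G x i l + _]addrC.
Qed.

Lemma ricci_identity Y i j x : smooth_mx U Y -> U x ->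
  cov G i (cov G j Y) x - cov G j (cov G i Y) x = Y x *m Rm i j x.
Proof.
move=> Ys Ux; have S := smooth_conn.
have E a b : cov G a (cov G b Y) x = dmx a (dmx b Y) x +
   (dmx a Y x *m Gam b x + Y x *m dmx a (Gam b) x) +
   (dmx b Y x *m Gam a x + Y x *m (Gam b x *m Gam a x)).
  rewrite /cov (dmxD Uo) //; [|exact: smooth_dmx|exact: smooth_mxM].
  by rewrite (dmxM Uo) // mulmxDl mulmxA.
rewrite !E (dmxC Uo i j) // curv_mxE mulmxBr mulmxDr mulmxBr.
by mxlin.
Qed.

(** Differentiating metric compatibility once more and using that second partial derivatives of [G]
    commute leaves the curvature acting on [G]. *)
Lemma curv_skew i j x : U x -> G x *m (Rm i j x)^T = - (Rm i j x *m G x).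
Proof.
move=> Ux; have S := smooth_conn; have D := dmxG.
have E a b : dmx a (dmx b G) x = dmx a (Gam b) x *m G x + G x *m (dmx a (Gam b) x)^T
    + Gam b x *m Gam a x *m G x + G x *m (Gam b x *m Gam a x)^T
    + Gam b x *m G x *m (Gam a x)^T + Gam a x *m G x *m (Gam b x)^T.
  rewrite (@dmx_eq _ U _ _ _ _ _ (fun y => Gam b y *m G y + G y *m (Gam b y)^T)) //;
    last by move=> y Uy; exact: D.
  rewrite (dmxD Uo) //; [|exact: smooth_mxM|by apply: smooth_mxM => //; exact: smooth_mx_tr].
  rewrite !(dmxM Uo) //; last exact: smooth_mx_tr.
  rewrite dmx_tr D // mulmxDr mulmxDl trmx_mul !mulmxA.
  by mxlin.
have := dmxC Uo i j Gs Ux; rewrite !E => /eqP; rewrite -subr_eq0 => /eqP H.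
apply/eqP; rewrite -subr_eq0 opprK -H curv_mxE !(raddfB, raddfD) /=.
rewrite !(mulmxBl, mulmxDl, mulmxBr, mulmxDr); apply/eqP.
by mxlin.
Qed.

(** Absence of torsion swaps the direction with the row index inside each derivative, and the cyclic
    sum then cancels in pairs. *)
Lemma bianchi1 i j k x : U x ->
  row k (Rm i j x) + row i (Rm j k x) + row j (Rm k i x) = 0.
Proof.
move=> Ux; have S := smooth_conn.
have E a b c : row c (Rm a b x) = dmx a (fun y => row c (Gam b y)) x
    - dmx b (fun y => row c (Gam a y)) x
    + row c (Gam b x) *m Gam a x - row c (Gam a x) *m Gam b x.
  rewrite (dmx_row a (Gam b)) (dmx_row b (Gam a)) curv_mxE.
  by rewrite [LHS]raddfB /= [in LHS]raddfD /= [in LHS]raddfB /= !row_mul; mxlin.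
have F a b c : dmx a (fun y => row c (Gam b y)) x = dmx a (fun y => row b (Gam c y)) x.
  by apply: (dmx_eq Uo) => // y Uy; exact: conn_sym.
rewrite !E (F i j k) (F j k i) (F k i j) (conn_sym k j Ux) (conn_sym i k Ux) (conn_sym j i Ux).
by mxlin.
Qed.

(** [D a b c] is the commutator of the covariant derivative along [a] with the curvature
    endomorphism. The Christoffel terms for the indices [b] and [c] are left out, since they cancel
    in the cyclic sum; what remains is a Jacobi identity. *)
Lemma bianchi2 m i j x : U x ->
  let D a b c := dmx a (Rm b c) x + Rm b c x *m Gam a x - Gam a x *m Rm b c x in
  D m i j + D i j m + D j m i = 0.
Proof.
move=> Ux D; have S := smooth_conn.
have dS a b := smooth_dmx Uo a (S b).
have E a b c : D a b c = dmx a (dmx b (Gam c)) x - dmx a (dmx c (Gam b)) x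
   + dmx a (Gam c) x *m Gam b x + Gam c x *m dmx a (Gam b) x
   - dmx a (Gam b) x *m Gam c x - Gam b x *m dmx a (Gam c) x
   + dmx b (Gam c) x *m Gam a x - dmx c (Gam b) x *m Gam a x
   + Gam c x *m Gam b x *m Gam a x - Gam b x *m Gam c x *m Gam a x
   - Gam a x *m dmx b (Gam c) x + Gam a x *m dmx c (Gam b) x
   - Gam a x *m Gam c x *m Gam b x + Gam a x *m Gam b x *m Gam c x.
  have M p q := smooth_mxM Uo (S p) (S q).
  rewrite /D (@dmx_eq _ U Uo _ _ _ _ _ _ (fun y _ => curv_mxE G b c y)) // curv_mxE.
  rewrite (dmxB Uo) //; last by apply: smooth_mxD => //; exact: smooth_mxB.
  rewrite (dmxD Uo) //; last exact: smooth_mxB.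
  rewrite (dmxB Uo) // !(dmxM Uo) //.
  rewrite !(mulmxBl, mulmxDl, mulmxBr, mulmxDr) !mulmxA.
  by mxlin.
rewrite !E (dmxC Uo m i) // (dmxC Uo m j) // (dmxC Uo i j) //.
by mxlin.
Qed.

(** The classical argument: four instances of the first Bianchi identity, combined with skewness in
    each pair, imply pair symmetry linearly. *)
Lemma curv_pair i j k l x : U x ->
  (Rm i j x *m G x) k l = (Rm k l x *m G x) i j.
Proof.
move=> Ux; pose r a b c d := (Rm a b x *m G x) c d.
have A1 a b c d : r a b c d = - r b a c d by rewrite /r curv_mxN mulNmx mxE.
have A2 a b c d : r a b c d = - r a b d c.
  have := curv_skew a b Ux; have -> : G x *m (Rm a b x)^T = (Rm a b x *m G x)^T.
    by rewrite trmx_mul GT.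
  by move/matrixP/(_ d c); rewrite !mxE /r !mxE.
have B a b c d : r a b c d + r b c a d + r c a b d = 0.
  have E p q s : r p q s d = (row s (Rm p q x) *m G x) 0 d by rewrite -row_mul mxE.
  by rewrite !E -!addmxE -!mulmxDl bianchi1 // mul0mx mxE.
have := (A2 j k l i, A2 k l j i, A1 l j k i, A2 j l k i, A2 l i k j, A1 i k l j, A2 k i l j).
have := (A2 i j l k, B i j k l, B j k l i, B k l i j, B l i j k).
rewrite -/(r i j k l) -/(r k l i j); move: r {A1 A2 B} => r E1 E2.
move: E1 E2 => [[[[E1 E2] E3] E4] E5] [[[[[[E6 E7] E8] E9] E10] E11] E12].
by lra.
Qed.

End Metric.

(** * Duality of bivectors *)

Local Notation ord4 k := (@Ordinal 4 k isT).

(** Indexing entries by natural numbers lets them compute at literal indices, so that identities of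
    4 by 4 matrices reduce to [ring] on each entry. *)
Definition nat_mx {R : realType} (m : nat -> nat -> R) : 'M[R]_4 := \matrix_(i, j) m i j.

Definition skew6 {R : realType} (a b c d e f : R) : 'M[R]_4 :=
  nat_mx (fun i j => nth 0 (nth [::] [::
  [:: 0; a; b; c]; [:: - a; 0; d; e]; [:: - b; - d; 0; f]; [:: - c; - e; - f; 0]] i) j).

(* Half the contraction of a skew [B] with the permutation symbol. *)
HB.lock Definition dual4 {R : realType} (B : 'M[R]_4) : 'M[R]_4 :=
  skew6 (B (ord4 2) (ord4 3)) (- B (ord4 1) (ord4 3)) (B (ord4 1) (ord4 2)) (B (ord4 0) (ord4 3))
        (- B (ord4 0) (ord4 2)) (B (ord4 0) (ord4 1)).

Section Dual.
Context {R : realType}.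
Implicit Types (A B X : 'M[R]_4) (f g m : nat -> nat -> R).

Lemma nat_mxP A : exists m, A = nat_mx m.
Proof.
exists (fun i j => A (inord i) (inord j)).
by apply/matrixP => i j; rewrite mxE !inord_val.
Qed.

Lemma ord4P (P : 'I_4 -> Prop) : P (ord4 0) -> P (ord4 1) -> P (ord4 2) -> P (ord4 3) ->
  forall i, P i.
Proof.
move=> P0 P1 P2 P3 [[|[|[|[|i]]]] Hi] //.
- by rewrite (_ : Ordinal Hi = ord4 0) //; apply: val_inj.
- by rewrite (_ : Ordinal Hi = ord4 1) //; apply: val_inj.
- by rewrite (_ : Ordinal Hi = ord4 2) //; apply: val_inj.
- by rewrite (_ : Ordinal Hi = ord4 3) //; apply: val_inj.
Qed.

Lemma sum4 (F : 'I_4 -> R) : \sum_i F i = F (ord4 0) + F (ord4 1) + F (ord4 2) + F (ord4 3).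
Proof.
rewrite !big_ord_recl big_ord0 addr0 !addrA.
by congr (_ + _ + _ + _); congr F; apply: val_inj.
Qed.

Lemma nat_mx_eq f g : (forall i j, (i < 4)%N -> (j < 4)%N -> f i j = g i j) ->
  nat_mx f = nat_mx g.
Proof. by move=> fg; apply/matrixP => i j; rewrite !mxE fg. Qed.

Lemma nat_mxM f g : nat_mx f *m nat_mx g =
  nat_mx (fun i j => f i 0%N * g 0%N j + f i 1%N * g 1%N j + f i 2%N * g 2%N j + f i 3%N * g 3%N j).
Proof. by apply/matrixP => i j; rewrite mxE sum4 !mxE. Qed.

Lemma nat_mxD f g : nat_mx f + nat_mx g = nat_mx (fun i j => f i j + g i j).
Proof. by apply/matrixP => i j; rewrite !mxE. Qed.

Lemma nat_mxN f : - nat_mx f = nat_mx (fun i j => - f i j).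
Proof. by apply/matrixP => i j; rewrite !mxE. Qed.

Lemma nat_mxZ c f : c *: nat_mx f = nat_mx (fun i j => c * f i j).
Proof. by apply/matrixP => i j; rewrite !mxE. Qed.

Lemma nat_mxT f : (nat_mx f)^T = nat_mx (fun i j => f j i).
Proof. by apply/matrixP => i j; rewrite !mxE. Qed.

Lemma nat_mx_scalar (c : R) : c%:M = nat_mx (fun i j => if i == j then c else 0).
Proof. by apply/matrixP => i j; rewrite !mxE -val_eqE; case: (_ == _). Qed.

Lemma nat_mx_trace f : \tr (nat_mx f) = f 0%N 0%N + f 1%N 1%N + f 2%N 2%N + f 3%N 3%N.
Proof. by rewrite /mxtrace sum4 !mxE. Qed.

Lemma nat_mx_dual f : dual4 (nat_mx f) =
  skew6 (f 2%N 3%N) (- f 1%N 3%N) (f 1%N 2%N) (f 0%N 3%N) (- f 0%N 2%N) (f 0%N 1%N).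
Proof. by rewrite dual4.unlock !mxE. Qed.

Lemma dual4_skew6 (a b c d e f : R) : dual4 (skew6 a b c d e f) = skew6 f (- e) d c (- b) a.
Proof. by rewrite dual4.unlock !mxE. Qed.

End Dual.

Ltac nat_mxs := rewrite ?dual4_skew6 ?nat_mx_dual /skew6
  ?(nat_mxM, nat_mxD, nat_mxN, nat_mxZ, nat_mxT, nat_mx_scalar, nat_mx_trace).
Ltac entries4 := nat_mxs; apply: nat_mx_eq; case=> [|[|[|[|?]]]]; case=> [|[|[|[|?]]]] //= _ _.

Section DualTheory.
Context {R : realType}.
Implicit Types (A B X G : 'M[R]_4).

Lemma skew6P B : B^T = - B -> exists a b c d e f, B = skew6 a b c d e f.
Proof.
move=> BT; have E i j : B i j = - B j i by move/matrixP/(_ j i) : BT; rewrite !mxE.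
have D i : B i i = 0 by have := E i i; lra.
exists (B (ord4 0) (ord4 1)), (B (ord4 0) (ord4 2)), (B (ord4 0) (ord4 3)).
exists (B (ord4 1) (ord4 2)), (B (ord4 1) (ord4 3)), (B (ord4 2) (ord4 3)).
by apply/matrixP; apply: ord4P; apply: ord4P; rewrite mxE /= ?D //.
Qed.

Lemma skew6_skew a b c d e f : (skew6 a b c d e f : 'M[R]_4)^T = - skew6 a b c d e f.
Proof. by entries4; rewrite ?oppr0 ?opprK. Qed.

Lemma dual4_skew B : (dual4 B)^T = - dual4 B.
Proof. by rewrite dual4.unlock; exact: skew6_skew. Qed.

Lemma dual4K B : B^T = - B -> dual4 (dual4 B) = B.
Proof. by move/skew6P => [a [b [c [d [e [f ->]]]]]]; rewrite !dual4_skew6 !opprK. Qed.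

Lemma dual4D A B : dual4 (A + B) = dual4 A + dual4 B.
Proof.
have [m ->] := nat_mxP A; have [n ->] := nat_mxP B.
by rewrite nat_mxD; entries4; ring.
Qed.

Lemma dual4Z c A : dual4 (c *: A) = c *: dual4 A.
Proof. by have [m ->] := nat_mxP A; rewrite nat_mxZ; entries4; ring. Qed.

(* The derivative at the identity of [dual4_congr]. *)
Lemma dual4_infinitesimal X B : B^T = - B ->
  dual4 (X *m B + B *m X^T) = \tr X *: dual4 B - X^T *m dual4 B - dual4 B *m X.
Proof.
move/skew6P => [a [b [c [d [e [f ->]]]]]]; have [m ->] := nat_mxP X.
rewrite dual4_skew6 [in LHS]/skew6 nat_mxT !nat_mxM nat_mxD nat_mx_dual.
by entries4; ring.
Qed.

(** This polarizes the Pfaffian identity: [dual4 A *m A] is minus the Pfaffian of [A] times the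
    identity. It is the Clifford relation behind both the commutation of the two eigenspaces and the
    scalar squares. *)
Lemma dual4_anticomm A B : A^T = - A -> B^T = - B ->
  dual4 A *m B + dual4 B *m A = (2^-1 * \tr (dual4 A *m B))%:M.
Proof.
move/skew6P => [a [b [c [d [e [f ->]]]]]]; move/skew6P => [a' [b' [c' [d' [e' [f' ->]]]]]].
by entries4; field.
Qed.

Lemma dual4_adjoint A B : A^T = - A -> B^T = - B ->
  \tr (dual4 A *m B) = \tr (A *m dual4 B).
Proof.
move/skew6P => [a [b [c [d [e [f ->]]]]]]; move/skew6P => [a' [b' [c' [d' [e' [f' ->]]]]]].
by nat_mxs => /=; ring.
Qed.

(** This is the Laplace expansion along the first two rows, the form in which 2 by 2 minors of a
    congruence recombine. *)
Lemma det4 m :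
  let minor i j k l := m i k * m j l - m i l * m j k in
  \det (nat_mx m : 'M[R]_4) =
  minor 0%N 1%N 0%N 1%N * minor 2%N 3%N 2%N 3%N - minor 0%N 1%N 0%N 2%N * minor 2%N 3%N 1%N 3%N
  + minor 0%N 1%N 0%N 3%N * minor 2%N 3%N 1%N 2%N + minor 0%N 1%N 1%N 2%N * minor 2%N 3%N 0%N 3%N
  - minor 0%N 1%N 1%N 3%N * minor 2%N 3%N 0%N 2%N + minor 0%N 1%N 2%N 3%N * minor 2%N 3%N 0%N 1%N.
Proof.
move=> minor; rewrite (expand_det_row _ ord0) sum4 /cofactor.
rewrite !(expand_det_row _ ord0) !big_ord_recl !big_ord0 /cofactor.
rewrite !(expand_det_row _ ord0) !big_ord_recl !big_ord0 /cofactor !det_mx11.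
rewrite !mxE /= /bump /= ?(addn0, add0n, addn1, add1n, addnS) !exprS expr0.
by rewrite /minor; ring.
Qed.

End DualTheory.

Section DualCongruence.
Context {R : realType}.
Implicit Types (A B X G : 'M[R]_4).

Lemma levi_nat i j k l : levi_symbol R i j k l =
  \det (nat_mx (fun a b => (nth 0%N [:: i : nat; j : nat; k : nat; l : nat] a == b)%:R) : 'M[R]_4).
Proof.
rewrite /levi_symbol; congr (\det _); apply/matrixP; apply: ord4P => b; rewrite !mxE;
by rewrite (tnth_nth ord0).
Qed.

Lemma dual4_levi A k l : A^T = - A ->
  2^-1 * \sum_i \sum_j A i j * levi_symbol R i j k l = dual4 A k l.
Proof.
move/skew6P => [a [b [c [d [e [f ->]]]]]].
rewrite dual4_skew6; under eq_bigr do (under eq_bigr do rewrite levi_nat det4 /=).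
move: k l; apply: ord4P; apply: ord4P; rewrite /= !mul0r ?mulr0 ?mul1r ?subr0 ?sub0r ?add0r ?addr0.
all: rewrite !sum4 /skew6 !mxE /=.
all: by field.
Qed.

Lemma skew6_congr m a b c d e f :
  let q i j := a * (m i 0%N * m j 1%N - m i 1%N * m j 0%N)
    + b * (m i 0%N * m j 2%N - m i 2%N * m j 0%N)
    + c * (m i 0%N * m j 3%N - m i 3%N * m j 0%N)
    + d * (m i 1%N * m j 2%N - m i 2%N * m j 1%N)
    + e * (m i 1%N * m j 3%N - m i 3%N * m j 1%N)
    + f * (m i 2%N * m j 3%N - m i 3%N * m j 2%N) : R in
  nat_mx m *m skew6 a b c d e f *m (nat_mx m)^T =
  skew6 (q 0%N 1%N) (q 0%N 2%N) (q 0%N 3%N) (q 1%N 2%N) (q 1%N 3%N) (q 2%N 3%N).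
Proof.
move=> q; rewrite nat_mxT /skew6 nat_mxM.
(* The product of the first two factors is written out without its zero terms before the second
   multiplication. *)
rewrite (@nat_mx_eq _ _ (fun i j => nth 0 [:: - (m i 1%N * a + m i 2%N * b + m i 3%N * c);
   m i 0%N * a - m i 2%N * d - m i 3%N * e; m i 0%N * b + m i 1%N * d - m i 3%N * f;
   m i 0%N * c + m i 1%N * e + m i 2%N * f] j)); last first.
  by move=> i; case=> [|[|[|[|?]]]] //= _ _; ring.
rewrite nat_mxM.
apply: nat_mx_eq; case=> [|[|[|[|?]]]]; case=> [|[|[|[|?]]]] //= _ _; rewrite /q; ring.
Qed.

Lemma skew6Z (r a b c d e f : R) :
  r *: skew6 a b c d e f = skew6 (r * a) (r * b) (r * c) (r * d) (r * e) (r * f).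
Proof.
rewrite [in LHS]/skew6 nat_mxZ; apply: nat_mx_eq.
by case=> [|[|[|[|?]]]]; case=> [|[|[|[|?]]]] //= _ _; ring.
Qed.

(** The permutation symbol is a 4-form, and its pullback by [X] is multiplied by [\det X]. In
    coordinates these are Laplace expansions over complementary minors. *)
Lemma dual4_congr X B : B^T = - B ->
  X^T *m dual4 (X *m B *m X^T) *m X = \det X *: dual4 B.
Proof.
move/skew6P => [a [b [c [d [e [f ->]]]]]]; have [m ->] := nat_mxP X.
rewrite det4 skew6_congr !dual4_skew6.
have := @skew6_congr (fun i j => m j i); rewrite -nat_mxT trmxK => /= ->.
by rewrite skew6Z; congr (skew6 _ _ _ _ _ _); ring.
Qed.
End DualCongruence.

(** * Eigenspaces of the Hodge star on bivectors *)

Section DualEigen.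
Context {R : realType}.
Implicit Types (A B E L G : 'M[R]_4) (t : R).

(* When [t ^+ 2 = \det G], these are the bivectors of one of the two eigenspaces of
   the Hodge star; the sign of [t] selects the eigenspace. *)
Definition dual_eigen t G B := B^T = - B /\ G *m B *m G = t *: dual4 B.

Lemma hodge_starE o G w : G^T = G -> w^T = - w ->
  hodge_star o G w = ((-1) ^+ o * Num.sqrt `|\det G|) *: dual4 (invmx G *m w *m invmx G).
Proof.
move=> GT wT; have iT : (invmx G)^T = invmx G by rewrite trmx_inv GT.
have AT : (invmx G *m w *m invmx G)^T = - (invmx G *m w *m invmx G).
  by rewrite !trmx_mul iT wT mulNmx mulmxN mulmxA.
apply/matrixP => k l; rewrite /hodge_star [LHS]mxE [RHS]mxE -(dual4_levi k l AT).
rewrite mulrCA; congr (_ * _); rewrite mulr_sumr; apply: eq_bigr => i _.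
by rewrite mulr_sumr; apply: eq_bigr => j _; rewrite /raise2 iT mulrCA.
Qed.

Variables (G : 'M[R]_4) (t : R).
Hypotheses (GT : G^T = G) (Gu : G \in unitmx) (tG : t ^+ 2 = \det G).

Lemma eigen_neq0 : t != 0.
Proof.
by apply: contraTneq Gu => t0; rewrite unitmxE unitfE negbK -tG t0 expr0n.
Qed.

(** The map from [A] to [t *: (invmx G *m dual4 A *m invmx G)] is a Hodge star on bivectors. It is
    an involution because the factor [\det (invmx G)] from [dual4_congr] cancels against
    [t ^+ 2]. *)
Lemma dual4_inv A : A^T = - A ->
  t *: dual4 (t *: (invmx G *m dual4 A *m invmx G)) = G *m A *m G.
Proof.
move=> AT; have iT : (invmx G)^T = invmx G by rewrite trmx_inv GT.
have := dual4_congr (invmx G) (dual4_skew A); rewrite iT dual4K // => H.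
rewrite dual4Z scalerA -expr2 tG.
have -> : G *m A *m G = \det G *: (G *m (\det (invmx G) *: A) *m G).
  by rewrite -scalemxAr -scalemxAl scalerA det_inv mulrV ?scale1r // -unitmxE.
by rewrite -H !mulmxA mulmxV // mul1mx mulmxKV.
Qed.

(** The sum of [A] and its star is twice the projection to the eigenspace. Applied with [A] constant
    and [G] varying, this produces smooth local sections; [eigen_projK] shows that starting from
    half a given eigenvector recovers it at the point. *)
Lemma eigen_proj A : A^T = - A ->
  dual_eigen t G (A + t *: (invmx G *m dual4 A *m invmx G)).
Proof.
move=> AT; have iT : (invmx G)^T = invmx G by rewrite trmx_inv GT.
split.
  by rewrite [LHS]raddfD /= [(_ *: _)^T]linearZ /= !trmx_mul iT AT dual4_skew mulNmx mulmxN
    mulmxA scalerN opprD.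
rewrite dual4D scalerDr dual4_inv // mulmxDr mulmxDl addrC; congr (_ + _).
by rewrite -scalemxAr -scalemxAl !mulmxA mulmxV // mul1mx mulmxKV.
Qed.

Lemma eigen_projK B : dual_eigen t G B ->
  2^-1 *: B + t *: (invmx G *m dual4 (2^-1 *: B) *m invmx G) = B.
Proof.
move=> [BT HB]; rewrite dual4Z -scalemxAr -scalemxAl scalerA mulrC -scalerA.
have -> : t *: (invmx G *m dual4 B *m invmx G) = B.
  by rewrite scalemxAl scalemxAr -HB !mulmxA mulVmx // mul1mx mulmxK.
by rewrite -scalerDl -[RHS]scale1r; congr (_ *: _); field.
Qed.

(** [dual4] is self-adjoint for the trace form, so moving it from one factor to the other shows that
    the trace equals its own negative. *)
Lemma eigen_opp_trace A B : dual_eigen (- t) G A -> dual_eigen t G B ->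
  \tr (G *m A *m G *m B) = 0.
Proof.
move=> [AT HA] [BT HB].
have E : \tr (G *m A *m G *m B) = \tr (A *m (G *m B *m G)).
  by rewrite -!mulmxA mxtrace_mulC !mulmxA.
have : \tr (G *m A *m G *m B) = - \tr (G *m A *m G *m B).
  rewrite {1}HA E HB -scalemxAl -scalemxAr !mxtraceZ mulNr.
  by rewrite dual4_adjoint.
by move/eqP; rewrite -addr_eq0 -mulr2n mulrn_eq0 => /eqP.
Qed.

(** The two eigenspaces are the two commuting ideals of the Lie algebra of skew endomorphisms. Here
    the scalar in [dual4_anticomm] vanishes by orthogonality, and the opposite eigenvalue signs turn
    anticommutation into commutation. *)
Lemma eigen_opp_comm A B : dual_eigen (- t) G A -> dual_eigen t G B ->
  G *m A *m G *m B = G *m B *m G *m A.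
Proof.
move=> HA' HB'; move: (HA') (HB') => [AT HA] [BT HB].
have Z := eigen_opp_trace HA' HB'.
have Z2 : \tr (dual4 A *m B) = 0.
  apply/eqP; rewrite -(mulrI_eq0 _ (mulfI (_ : - t != 0))) ?oppr_eq0 ?eigen_neq0 //.
  by rewrite -mxtraceZ scalemxAl -HA Z.
have := dual4_anticomm AT BT; rewrite Z2 mulr0 raddf0 => /eqP; rewrite addr_eq0 => /eqP H.
by rewrite HA HB -!scalemxAl H scaleNr scalerN opprK.
Qed.

Lemma eigen_sq B : dual_eigen t G B ->
  G *m B *m G *m B = (4^-1 * \tr (G *m B *m G *m B))%:M.
Proof.
move=> [BT HB]; rewrite HB -scalemxAl mxtraceZ.
have := dual4_anticomm BT BT; rewrite -mulr2n -scaler_nat => /(congr1 (fun M => (t / 2) *: M)).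
rewrite scalerA mulfVK ?pnatr_eq0 // => ->; rewrite -[_%:M]scalemx1 scalerA scalemx1.
by congr (_%:M); field.
Qed.

(** The eigenbundle is parallel: with [L] a connection matrix, the displayed bivector is the
    covariant derivative of [B], and the last hypothesis is the derivative of the eigenvalue
    equation. The number [dt] is arbitrary; its deviation [c] from [t * \tr L] measures the failure
    of [t] to be a parallel density. *)
Lemma eigen_cov B dB L dG dt : dual_eigen t G B -> dB^T = - dB ->
  dG = L *m G + G *m L^T ->
  dG *m B *m G + G *m dB *m G + G *m B *m dG = dt *: dual4 B + t *: dual4 dB ->
  dual_eigen t G (dB + (L^T *m B + B *m L)).
Proof.
move=> [BT HB] dBT dGE dE; set E := dB + _; pose c := dt - t * \tr L.
have ET : E^T = - E.
  by rewrite /E !linearD /= !trmx_mul trmxK dBT BT mulNmx mulmxN; mxlin.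
have t0 := eigen_neq0.
have H1 : G *m E *m G = t *: dual4 E + c *: dual4 B.
  have I : dual4 (L^T *m B + B *m L) = \tr L *: dual4 B - L *m dual4 B - dual4 B *m L^T.
    by have := dual4_infinitesimal L^T BT; rewrite trmxK mxtrace_tr.
  have -> : G *m E *m G =
      (dt *: dual4 B + t *: dual4 dB) - L *m (G *m B *m G) - (G *m B *m G) *m L^T.
    by rewrite -dE dGE !(mulmxDl, mulmxDr) !mulmxA; mxlin.
  by rewrite HB dual4D I /c -scalemxAr -scalemxAl; mxlin.
(* Dualizing both sides reverses the sign of the [c] term, so that it vanishes. *)
have H2 : t *: (G *m E *m G) + c *: (G *m B *m G) = t ^+ 2 *: dual4 E.
  have := dual4_congr G ET; rewrite GT -tG H1 dual4D !dual4Z !dual4K // => <-.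
  by rewrite mulmxDr mulmxDl -!scalemxAr -!scalemxAl H1.
have H3 : c *: dual4 B = 0.
  apply/eqP; have : (t *+ 2) *: (c *: dual4 B) == 0.
    move/eqP: H2; rewrite H1 HB -subr_eq0 => /eqP H2; rewrite -[X in _ == X]H2; apply/eqP.
    by mxlin.
  by rewrite scaler_eq0 mulrn_eq0 /= (negbTE t0).
by split=> //; rewrite H1 H3 addr0.
Qed.

End DualEigen.

(** * Solitons with null gradient *)

Section Rows.
Context {R : realType}.
Implicit Types (A C M : 'M[R]_4).

Lemma trace_rows A C M i j : \tr ((row j C)^T *m row i A *m M) = (A *m M *m C^T) i j.
Proof.
rewrite -mulmxA mxtrace_mulC /mxtrace big_ord1 -row_mul.
by rewrite !mxE; apply: eq_bigr => k _; rewrite !mxE.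
Qed.

Lemma rows_colE A C (v : 'cV[R]_4) i j k :
  ((row j A)^T *m row k C *m v) i 0 = A j i * (C *m v) k 0.
Proof. by rewrite -mulmxA -row_mul mxE big_ord1 !mxE. Qed.

Lemma mul_rows_colE A C M (v : 'cV[R]_4) i j k :
  (M *m ((row j A)^T *m row k C) *m v) i 0 = (M *m A^T) i j * (C *m v) k 0.
Proof.
rewrite -!mulmxA -row_mul mulmxA mxE big_ord1 [(row _ _) _ _]mxE; congr (_ * _).
by rewrite !mxE; apply: eq_bigr => l _; rewrite !mxE.
Qed.

End Rows.

Section DualField.
Context {R : realType} (U : set 'rV[R]_4) (Uo : open U).
Variable B : 'rV[R]_4 -> 'M[R]_4.
Hypothesis Bs : smooth_mx U B.

Lemma smooth_dual4 : smooth_mx U (fun x => dual4 (B x)).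
Proof.
rewrite /smooth_mx dual4.unlock; apply: ord4P; apply: ord4P;
  do ?[by apply: (smooth_eq Uo _ (smooth_cst U 0)) => y _; rewrite mxE
      |by apply: (smooth_eq Uo _ (Bs _ _)) => y _; rewrite mxE /= ?opprK
      |by apply: (smooth_eq Uo _ (smoothN Uo (Bs _ _))) => y _; rewrite mxE /= ].
Qed.

Lemma dmx_dual4 i x : U x -> dmx i (fun y => dual4 (B y)) x = dual4 (dmx i B x).
Proof.
move=> Ux; have E (F H : 'rV[R]_4 -> R) : F = H -> partial i F x = partial i H x by move->.
apply/matrixP; rewrite dual4.unlock; apply: ord4P; apply: ord4P; rewrite dmxE [RHS]mxE /= ?dmxE;
  do ?[by rewrite -[RHS](partial_cst i 0 x); apply: E; apply/funext => y; rewrite mxE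
      |by apply: E; apply/funext => y; rewrite mxE
      |by rewrite ?opprK; apply: E; apply/funext => y; rewrite mxE /= ?opprK
      |by rewrite -[RHS](partialN i (Bs _ _) Ux); apply: E; apply/funext => y; rewrite mxE].
Qed.

End DualField.

(** * The identity of 3-forms satisfied by a soliton with null gradient *)

Section SolitonEquation.
Context {R : realType} (U : set 'rV[R]_4) (Uo : open U) (G : 'rV[R]_4 -> 'M[R]_4).
Hypotheses (Gs : smooth_mx U G) (GT : forall x, U x -> (G x)^T = G x)
  (Gu : forall x, U x -> G x \in unitmx).
Variables (f lam : 'rV[R]_4 -> R).
Hypotheses (fs : smooth_on U f) (ls : smooth_on U lam)
  (sol : forall x, U x -> ricci G x + f x *: hessian G f x = lam x *: G x)
  (nul : forall x, U x -> inner (G x) (gradient G f x) (gradient G f x) = 0).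
Implicit Types (i j k l m : 'I_4).

Local Notation Gam := (conn_mx G).
Local Notation Rm := (curv_mx G).
Local Notation N := (gradient G f).
Local Notation h := (hessian G f).

Definition differential (x : 'rV[R]_4) : 'rV[R]_4 := \row_j partial j f x.

Lemma gradient_lower x : U x -> N x *m G x = differential x.
Proof. by move=> Ux; rewrite gradientE (invmxT GT) // mulmxKV // Gu. Qed.

Lemma gradient_lowerT x : U x -> G x *m (N x)^T = (differential x)^T.
Proof. by move=> Ux; rewrite -gradient_lower // trmx_mul GT. Qed.

Lemma smooth_differential : smooth_mx U differential.
Proof.
move=> a b; apply: (@smooth_eq _ _ Uo (partial b f)); first by move=> y _; rewrite mxE.
exact: smooth_partial.
Qed.

Lemma smooth_gradient : smooth_mx U N.
Proof.
apply: (@smooth_mx_eq _ _ Uo _ _ (fun x => differential x *m (invmx (G x))^T)).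
  by move=> y _; rewrite gradientE.
apply: smooth_mxM => //; first exact: smooth_differential.
by apply: smooth_mx_tr => //; exact: smooth_inv.
Qed.

(** Differentiating the lowered gradient and using metric compatibility identifies the Hessian with
    the lowered covariant derivative of the gradient, on which all later uses rely. *)
Lemma hessian_row i x : U x -> row i (h x) = cov G i N x *m G x.
Proof.
move=> Ux; have D : dmx i (fun y => N y *m G y) x = dmx i differential x.
  by apply: (dmx_eq Uo) => // y; exact: gradient_lower.
apply/rowP => j; rewrite mxE hessian_entry.
have -> : partial i (partial j f) x = dmx i differential x 0 j.
  by rewrite dmxE; congr partial; apply/funext => y; rewrite mxE.
rewrite -/(differential x) -D -gradient_lower // (dmxM Uo) //; last exact: smooth_gradient.
rewrite (dmxG Uo GT Gu) // -[in LHS]oppmxE -addmxE; congr (fun_of_matrix _ _ _).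
rewrite /cov mulmxDl mulmxDr !mulmxA.
by mxlin.
Qed.

Lemma hessian_sym x : U x -> (h x)^T = h x.
Proof.
move=> Ux; apply/matrixP => i j; rewrite mxE !hessian_entry (smooth_partialC Uo i j) //.
congr (_ - _); rewrite ![(_ *m _) _ _]mxE; apply: eq_bigr => k _.
rewrite ![(_^T) _ _]mxE; congr (_ * _).
by have /rowP/(_ k) := conn_sym Uo GT j i Ux; rewrite !mxE.
Qed.

Lemma smooth_hessian : smooth_mx U h.
Proof.
move=> i j; apply: (@smooth_eq _ _ Uo (fun y => (cov G i N y *m G y) 0 j)).
  by move=> y Uy; rewrite -hessian_row // mxE.
have S := smooth_gradient; apply: smooth_mxM => //; apply: smooth_mxD => //.
  exact: smooth_dmx.
by apply: smooth_mxM => //; exact: smooth_conn.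
Qed.

Lemma hessian_gradient x : U x -> h x *m (N x)^T = 0.
Proof.
move=> Ux; have S := smooth_gradient.
have Z : forall y, U y -> N y *m G y *m (N y)^T = 0.
  by move=> y Uy; apply/matrixP => a b; rewrite !ord1 [RHS]mxE; exact: nul.
apply/row_matrixP => i; rewrite row0 row_mul hessian_row //.
have := @dmx_eq _ U Uo _ _ i _ _ x Z Ux; rewrite dmx_cst.
have ST := smooth_mx_tr Uo S.
rewrite !(dmxM Uo) //; last exact: smooth_mxM.
rewrite (dmxG Uo GT Gu) // (dmx_tr _ N) => H.
(* Metric compatibility splits the derivative of g(N,N) into two 1 by 1 blocks that are transposes
   of each other, hence equal. *)
have E : dmx i N x *m G x *m (N x)^T + N x *m Gam i x *m G x *m (N x)^T +
    (dmx i N x *m G x *m (N x)^T + N x *m Gam i x *m G x *m (N x)^T)^T = 0.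
  rewrite -[RHS]H linearD /= !trmx_mul !trmxK GT // !(mulmxDl, mulmxDr) !mulmxA.
  by mxlin.
have T1 (M : 'M[R]_1) : M^T = M by apply/matrixP => a b; rewrite mxE !ord1.
move: E; rewrite T1 -mulr2n -scaler_nat => /eqP; rewrite scaler_eq0 pnatr_eq0 /= => /eqP.
by rewrite /cov !mulmxDl.
Qed.

(* On the soliton the Schouten tensor is [schouten_scalar x *: G x - (f x / 2) *: h x]. *)
Definition schouten_scalar (x : 'rV[R]_4) : R := 2^-1 * (lam x - scalar_curvature G x / 6%:R).
Local Notation a := schouten_scalar.

Definition weyl_mx (x : 'rV[R]_4) i j : 'M[R]_4 := \matrix_(k, l) weyl G x i j k l.

(** This is the Kulkarni-Nomizu product of the metric with the Schouten tensor, the non-Weyl part of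
    the curvature. The metric paired with itself counts twice, hence [2 * a x]. *)
Definition schouten_mx (x : 'rV[R]_4) i j : 'M[R]_4 :=
  (2 * a x) *: ((row j (G x))^T *m row i (G x) - (row i (G x))^T *m row j (G x))
  - (f x / 2) *: ((row j (h x))^T *m row i (G x) - (row i (G x))^T *m row j (h x)
                  + (row j (G x))^T *m row i (h x) - (row i (h x))^T *m row j (G x)).

Lemma ricci_soliton x : U x -> ricci G x = lam x *: G x - f x *: h x.
Proof. by move=> Ux; rewrite -sol // addrK. Qed.

Lemma curv_decomposition i j x : U x -> Rm i j x *m G x = weyl_mx x i j + schouten_mx x i j.
Proof.
move=> Ux; apply/matrixP => k l; rewrite addmxE [weyl_mx _ _ _ _ _]mxE /weyl riemannE.
rewrite ricci_soliton // /schouten_mx !(addmxE, oppmxE, scalemxE).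
have E (A C : 'M[R]_4) p q : ((row p A)^T *m row q C) k l = A p k * C q l.
  by rewrite mxE big_ord1 !mxE.
rewrite !E /schouten_scalar; move: (curv_mx G i j x *m G x) (scalar_curvature G x) => r s.
move: (lam x) (f x) (G x) (h x) => p q g0 h0.
by field.
Qed.

Lemma smooth_ricci : smooth_mx U (ricci G).
Proof.
move=> j k; apply: (@smooth_eq _ _ Uo (fun x => \sum_i Rm i j x k i)).
  by move=> y _; rewrite ricciE.
by apply: smooth_sum => // i _; exact: smooth_curv.
Qed.

Lemma smooth_schouten_scalar : smooth_on U a.
Proof.
apply: smoothM => //; first exact: smooth_cst.
apply: smoothB => //; apply: smoothM => //; last exact: smooth_cst.
apply: smooth_trace => //; apply: smooth_mxM => //; last exact: smooth_ricci.
exact: smooth_inv.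
Qed.

(** With J the endomorphism of the bivector [K], this is h J + J h with both indices lowered. *)
Definition tau (K : 'M[R]_4) (x : 'rV[R]_4) : 'M[R]_4 :=
  G x *m K *m h x + h x *m K *m G x.

Lemma sandwich_skew x K : U x -> K^T = - K -> (G x *m K *m G x)^T = - (G x *m K *m G x).
Proof. by move=> Ux KT; rewrite !trmx_mul GT // KT mulNmx mulmxN mulmxA. Qed.

Lemma tau_entry x K i j : U x -> K^T = - K ->
  (h x *m K *m G x) i j = - (G x *m K *m h x) j i.
Proof.
move=> Ux KT; have -> : h x *m K *m G x = - (G x *m K *m h x)^T.
  by rewrite !trmx_mul hessian_sym // GT // KT mulNmx mulmxN opprK mulmxA.
by rewrite !mxE.
Qed.

Variable t : 'rV[R]_4 -> R.
Hypotheses (ts : smooth_on U t) (tG : forall x, U x -> t x ^+ 2 = \det (G x))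
  (We : forall x i j, U x ->
    dual_eigen (- t x) (G x) (invmx (G x) *m weyl_mx x i j *m invmx (G x))).

Lemma weyl_mx_sandwich x i j : U x ->
  weyl_mx x i j = G x *m (invmx (G x) *m weyl_mx x i j *m invmx (G x)) *m G x.
Proof. by move=> Ux; rewrite !mulmxA mulmxV ?Gu // mul1mx mulmxKV // Gu. Qed.

(** The Weyl part lies in the opposite eigenspace and is orthogonal to [K]; the rank-one pieces of
    the Schouten part evaluate by [trace_rows]. *)
Lemma trace_curv_eigen K i j x : U x -> dual_eigen (t x) (G x) K ->
  \tr (Rm i j x *m G x *m K) = 4 * a x * (G x *m K *m G x) i j - f x * tau K x i j.
Proof.
move=> Ux Ke; have [KT _] := Ke.
rewrite curv_decomposition // mulmxDl mxtraceD {1}weyl_mx_sandwich //.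
rewrite (eigen_opp_trace (We i j Ux) Ke) add0r /schouten_mx.
have tB (P Q M : 'M[R]_4) : \tr ((P - Q) *m M) = \tr (P *m M) - \tr (Q *m M).
  by rewrite mulmxBl linearB.
have tD (P Q M : 'M[R]_4) : \tr ((P + Q) *m M) = \tr (P *m M) + \tr (Q *m M).
  by rewrite mulmxDl linearD.
have tZ c (P M : 'M[R]_4) : \tr ((c *: P) *m M) = c * \tr (P *m M).
  by rewrite -scalemxAl linearZ.
rewrite !(tB, tD, tZ) !trace_rows GT // hessian_sym // /tau addmxE.
have := @tau_entry x K i j Ux KT; have := @tau_entry x K j i Ux KT.
have -> : (G x *m K *m G x) j i = - (G x *m K *m G x) i j.
  by have /matrixP/(_ i j) := sandwich_skew Ux KT; rewrite !mxE.
move: (G x *m K *m G x) (h x *m K *m G x) (G x *m K *m h x) => w p q E1 E2.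
by rewrite E1 E2; field.
Qed.

(* The Weyl part of the curvature commutes with [G x *m K], and the first Bianchi
   identity removes the term in which the curvature acts last. *)
Lemma curv_gradient_cyclic K i m j x : U x -> dual_eigen (t x) (G x) K ->
  let v p q r := (G x *m K *m (Rm q r x *m G x) *m (N x)^T) p 0 in
  let w := G x *m K *m G x in
  let df := fun p => partial p f x in
  v i m j + v m j i + v j i m =
  4 * a x * (df m * w i j + df i * w j m + df j * w m i)
  - f x / 2 * (df m * tau K x i j + df i * tau K x j m + df j * tau K x m i).
Proof.
move=> Ux Ke v w df; have [KT _] := Ke.
pose S := schouten_mx x.
have key p q : G x *m K *m (Rm p q x *m G x) *m (N x)^T =
    Rm p q x *m (G x *m K *m G x *m (N x)^T) - S p q *m (K *m (G x *m (N x)^T))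
    + G x *m K *m S p q *m (N x)^T.
  have E : G x *m K *m weyl_mx x p q = weyl_mx x p q *m K *m G x.
    rewrite [in RHS]weyl_mx_sandwich // (eigen_opp_comm _ _ (We p q Ux) Ke) ?Gu ?tG //.
    by rewrite !mulmxA mulmxKV ?Gu // mulmxK ?Gu.
  rewrite curv_decomposition // mulmxDr E mulmxDl.
  have -> : Rm p q x *m (G x *m K *m G x *m (N x)^T) =
      (weyl_mx x p q + S p q) *m K *m G x *m (N x)^T.
    by rewrite -curv_decomposition // !mulmxA.
  by rewrite /S !mulmxDl !mulmxA; mxlin.
have jac : (Rm m j x *m (G x *m K *m G x *m (N x)^T)) i 0
   + (Rm j i x *m (G x *m K *m G x *m (N x)^T)) m 0
   + (Rm i m x *m (G x *m K *m G x *m (N x)^T)) j 0 = 0.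
  have E p q r (u : 'cV[R]_4) : (Rm p q x *m u) r 0 = (row r (Rm p q x) *m u) 0 0.
    by rewrite -row_mul [RHS]mxE.
  rewrite !E -!addmxE -!mulmxDl (_ : row i _ + _ + _ = 0) ?mul0mx ?mxE //.
  by rewrite -(bianchi1 Uo Gs GT Gu m j i Ux).
have vB (P Q : 'M[R]_4) (u : 'cV[R]_4) p : ((P - Q) *m u) p 0 = (P *m u) p 0 - (Q *m u) p 0.
  by rewrite mulmxBl addmxE oppmxE.
have vD (P Q : 'M[R]_4) (u : 'cV[R]_4) p : ((P + Q) *m u) p 0 = (P *m u) p 0 + (Q *m u) p 0.
  by rewrite mulmxDl addmxE.
have vZ c (P : 'M[R]_4) (u : 'cV[R]_4) p : ((c *: P) *m u) p 0 = c * (P *m u) p 0.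
  by rewrite -scalemxAl scalemxE.
have mB (M P Q : 'M[R]_4) (u : 'cV[R]_4) p :
    (M *m (P - Q) *m u) p 0 = (M *m P *m u) p 0 - (M *m Q *m u) p 0.
  by rewrite mulmxBr vB.
have mD (M P Q : 'M[R]_4) (u : 'cV[R]_4) p :
    (M *m (P + Q) *m u) p 0 = (M *m P *m u) p 0 + (M *m Q *m u) p 0.
  by rewrite mulmxDr vD.
have mZ c (M P : 'M[R]_4) (u : 'cV[R]_4) p :
    (M *m (c *: P) *m u) p 0 = c * (M *m P *m u) p 0.
  by rewrite -scalemxAr vZ.
have df_lower p : (G x *m (N x)^T) p 0 = df p by rewrite gradient_lowerT // !mxE.
have h0 p : (h x *m (N x)^T) p 0 = 0 by rewrite hessian_gradient // mxE.
have wT p q : w p q = - w q p.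
  by have /matrixP/(_ q p) := sandwich_skew Ux KT; rewrite !mxE.
have hT p q : h x p q = h x q p by rewrite -[in LHS]hessian_sym // mxE.
have gT p q : G x p q = G x q p by rewrite -[in LHS]GT // mxE.
have tE p q : tau K x p q = (G x *m K *m h x) p q - (G x *m K *m h x) q p.
  by rewrite /tau addmxE tau_entry.
pose n p := (G x *m (K *m (G x *m (N x)^T))) p 0.
pose k p := (h x *m (K *m (G x *m (N x)^T))) p 0.
pose q p r := (G x *m K *m h x) p r.
pose z p r s := (Rm r s x *m (w *m (N x)^T)) p 0.
(* In the cyclic sum the terms with [n] and [k] cancel by symmetry of [G x] and [h x], and those
   with [z] by [jac]. Only the terms with [w] and [q] survive. *)
have vE p r s : v p r s = z p r s
    - (2 * a x * (G x s p * n r - G x r p * n s)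
       - f x / 2 * (h x s p * n r - G x r p * k s + G x s p * k r - h x r p * n s))
    + (2 * a x * (w p s * df r - w p r * df s) - f x / 2 * (q p s * df r - q p r * df s)).
  have -> : v p r s = z p r s - (S r s *m (K *m (G x *m (N x)^T))) p 0
     + (G x *m K *m S r s *m (N x)^T) p 0.
    by rewrite /v key addmxE (addmxE _ (- _)) (oppmxE (_ *m _)).
  congr (_ - _ + _).
    by rewrite /S /schouten_mx vB !vZ vB [in X in _ - X]vB vD vB !rows_colE.
  rewrite /S /schouten_mx mB !mZ mB [in X in _ - X]mB mD mB !mul_rows_colE.
  by rewrite GT // hessian_sym // !df_lower !h0 !mulr0 addr0 subr0.
rewrite !vE !tE -/(q i j) -/(q j i) -/(q j m) -/(q m j) -/(q m i) -/(q i m).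
rewrite (gT j i) (gT m i) (gT j m) (hT j i) (hT m i) (hT j m).
rewrite (wT i m) (wT m j) (wT j i).
apply/eqP; rewrite -subr_eq0; apply/eqP; apply: etrans _ jac.
rewrite -/w -/(z i m j) -/(z m j i) -/(z j i m).
clear vE key vB vD vZ mB mD mZ df_lower h0 wT hT gT tE v.
move: (G x) (h x) (a x) (f x) => g1 h1 a1 f1.
clearbody z n k q w df.
by field.
Qed.

(** Absence of torsion: the Christoffel terms drop out of the exterior derivative of a 2-form, so
    covariant and partial derivatives give the same cyclic sum. *)
Lemma conn_cyclic (w : 'M[R]_4) i m j x : U x -> w^T = - w ->
  let D p := Gam p x *m w + w *m (Gam p x)^T in
  D m i j + D i j m + D j m i = 0.
Proof.
move=> Ux wT D; pose q p r s := (row r (Gam p x) *m w) 0 s.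
have E p r s : D p r s = q p r s - q p s r.
  have -> : D p = Gam p x *m w - (Gam p x *m w)^T.
    by rewrite /D trmx_mul wT mulNmx opprK.
  by rewrite addmxE oppmxE [(_^T) _ _]mxE /q -!row_mul ![(row _ _) _ _]mxE.
have Q p r s : q p r s = q r p s by rewrite /q (conn_sym Uo GT p r).
by rewrite !E (Q m i) (Q m j) (Q i j); ring.
Qed.

(** [H] is the covariant derivative of the Hessian. Since the Hessian is the lowered derivative of
    the gradient, its antisymmetrised derivative is given by the Ricci identity for the gradient;
    [G x *m K] is carried along on the left. *)
Lemma hessian_codazzi i p j x K : U x ->
  let H r := dmx r h x - Gam r x *m h x - h x *m (Gam r x)^T in
  (G x *m K *m H p) i j - (G x *m K *m H j) i p =
  - (G x *m K *m (Rm p j x *m G x) *m (N x)^T) i 0.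
Proof.
move=> Ux H; have NS := smooth_gradient.
have CS r : smooth_mx U (cov G r N).
  apply: smooth_mxD => //; first exact: smooth_dmx.
  by apply: smooth_mxM => //; exact: smooth_conn.
have HT r : (H r)^T = H r.
  have dhT : (dmx r h x)^T = dmx r h x.
    by rewrite -dmx_tr; apply: (dmx_eq Uo) Ux; exact: hessian_sym.
  by rewrite /H !linearB /= !trmx_mul trmxK hessian_sym // dhT; mxlin.
have Hrow r s : row s (H r) = cov G r (cov G s N) x *m G x - row s (Gam r x) *m h x.
  rewrite /H !linearB /= !row_mul hessian_row // -(dmx_row r h).
  rewrite (@dmx_eq _ U Uo _ _ _ _ (fun y => cov G s N y *m G y)) //; last first.
    by move=> y Uy; exact: hessian_row.
  by rewrite (dmxM Uo) // (dmxG Uo GT Gu) // [cov G r]/cov (mulmxDr (cov G s N x))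
    (mulmxDl (dmx r (cov G s N) x)) !mulmxA; mxlin.
have E r s : (G x *m K *m H r) i s = (G x *m K *m (row s (H r))^T) i 0.
  rewrite -[in LHS]HT mxE [RHS]mxE; apply: eq_bigr => c _.
  by congr (_ * _); rewrite !mxE.
clearbody H.
transitivity ((G x *m K *m (row j (H p) - row p (H j))^T) i 0).
  by rewrite !E linearB /= mulmxBr addmxE oppmxE.
have -> : row j (H p) - row p (H j) = N x *m Rm p j x *m G x.
  rewrite !Hrow (conn_sym Uo GT p j) // -(ricci_identity Uo Gs Gu) // mulmxBl.
  by mxlin.
have -> : (N x *m Rm p j x *m G x)^T = - (Rm p j x *m G x *m (N x)^T).
  by rewrite !trmx_mul GT // mulmxA (curv_skew Uo Gs GT Gu p j Ux) mulNmx.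
by rewrite mulmxN oppmxE !mulmxA.
Qed.

(* This compares two expressions of the exterior derivative of tr(R J): the second
   Bianchi identity on one side, [trace_curv_eigen] on the other. *)
Lemma soliton_three_form K i m j x : U x -> dual_eigen (t x) (G x) K ->
  let w := G x *m K *m G x in
  let df p := partial p f x in
  let b p := 4 * (partial p a x + a x * f x * df p) in
  b m * w i j + b i * w j m + b j * w m i =
  (1 + f x ^+ 2 / 2) * (df m * tau K x i j + df i * tau K x j m + df j * tau K x m i).
Proof.
move=> Ux Ke w df b; have [KT _] := Ke.
(* [eigen_proj] doubles an eigenvector, so half of [K] is extended; [B] is then a local section of
   the eigenbundle through [K]. *)
pose A := 2^-1 *: K.
have AT : A^T = - A by rewrite linearZ /= KT scalerN.
pose B y := A + t y *: (invmx (G y) *m dual4 A *m invmx (G y)).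
have Be y : U y -> dual_eigen (t y) (G y) (B y).
  by move=> Uy; apply: eigen_proj; rewrite ?GT ?Gu ?tG.
have Bx : B x = K by apply: eigen_projK; rewrite ?Gu.
have Is := smooth_inv Uo Gu Gs.
have Bs : smooth_mx U B.
  apply: smooth_mxD => //; first exact: smooth_mx_cst.
  apply: smooth_mxZ => //; apply: smooth_mxM => //; apply: smooth_mxM => //.
  exact: smooth_mx_cst.
clearbody B.
(* [E p] is the covariant derivative of the section. It stays in the eigenbundle but need not
   vanish. *)
pose E p := dmx p B x + ((Gam p x)^T *m K + K *m Gam p x).
have Ee p : dual_eigen (t x) (G x) (E p).
  apply: (eigen_cov (GT Ux) (Gu Ux) (tG Ux) Ke _ (dmxG Uo GT Gu p Ux) (dt := partial p t x)).
    rewrite -dmx_tr -(dmxN Uo) //; apply: (dmx_eq Uo) Ux => y Uy.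
    by have [] := Be y Uy.
  have GBs := smooth_mxM Uo Gs Bs.
  have := @dmx_eq _ U Uo _ _ p (fun y => G y *m B y *m G y) (fun y => t y *: dual4 (B y)) x.
  have Ds := smooth_dual4 Uo Bs.
  rewrite (dmxZ Uo) // !(dmxM Uo) // (dmx_dual4 Bs) // Bx mulmxDl => <- //.
  by move=> y Uy; have [] := Be y Uy.
pose H p := dmx p h x - Gam p x *m h x - h x *m (Gam p x)^T.
pose W y := G y *m B y *m G y.
pose T y := tau (B y) y.
have hs := smooth_hessian.
have Rs p q := smooth_curv Uo Gs Gu p q.
have Ws : smooth_mx U W by do !apply: smooth_mxM => //.
have Ts : smooth_mx U T by apply: smooth_mxD => //; do !apply: smooth_mxM => //.
have dW p : dmx p W x = G x *m E p *m G x + (Gam p x *m w + w *m (Gam p x)^T).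
  have GBs := smooth_mxM Uo Gs Bs.
  rewrite /W !(dmxM Uo) // (dmxG Uo GT Gu) // /E /w Bx !(mulmxDl, mulmxDr) !mulmxA.
  by mxlin.
have dT p : dmx p T x = tau (E p) x + (G x *m K *m H p + H p *m K *m G x)
    + (Gam p x *m tau K x + tau K x *m (Gam p x)^T).
  have GBs := smooth_mxM Uo Gs Bs; have hBs := smooth_mxM Uo hs Bs.
  rewrite /T /tau (dmxD Uo) //; [|exact: smooth_mxM|exact: smooth_mxM].
  rewrite !(dmxM Uo) // (dmxG Uo GT Gu) // /E /H Bx.
  rewrite !(mulmxDl, mulmxDr, mulmxBl, mulmxBr, mulNmx, mulmxN) !mulmxA.
  by mxlin.
pose D p r s := dmx p (Rm r s) x + Rm r s x *m Gam p x - Gam p x *m Rm r s x.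
(* The trace of curvature against [B] is differentiated directly and through [trace_curv_eigen]. The
   unknown [E p] contributes equally to both results, because [trace_curv_eigen] applies to [E p] as
   well. *)
have L p r s : \tr (D p r s *m G x *m K) =
    4 * partial p a x * w r s - df p * tau K x r s
    + 4 * a x * (Gam p x *m w + w *m (Gam p x)^T) r s
    - f x * (Gam p x *m tau K x + tau K x *m (Gam p x)^T) r s
    - f x * (G x *m K *m H p + H p *m K *m G x) r s.
  have RGs := smooth_mxM Uo (Rs r s) Gs.
  have RGBs := smooth_mxM Uo RGs Bs.
  have H1 : partial p (fun y => \tr (Rm r s y *m G y *m B y)) x =
      \tr (D p r s *m G x *m K) + \tr (Rm r s x *m G x *m E p).
    rewrite (partial_trace Uo) // !(dmxM Uo) // (dmxG Uo GT Gu) // Bx /D /E.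
    rewrite !(mulmxDl, mulmxDr, mulmxBl, mulmxBr, mulNmx, mulmxN) !mulmxA.
    have tN (M : 'M[R]_4) : \tr (- M) = - \tr M by rewrite linearN.
    rewrite !mxtraceD !tN.
    have -> : \tr (Rm r s x *m G x *m K *m Gam p x) = \tr (Gam p x *m Rm r s x *m G x *m K).
      by rewrite mxtrace_mulC !mulmxA.
    by ring.
  have a_smooth := smooth_schouten_scalar.
  have H2 : partial p (fun y => \tr (Rm r s y *m G y *m B y)) x =
      4 * (partial p a x * w r s + a x * dmx p W x r s)
      - (df p * tau K x r s + f x * dmx p T x r s).
    rewrite (@partial_eq_on _ U _ (fun y => 4 * (a y * W y r s) - f y * T y r s)) //; last first.
      by move=> y Uy; rewrite trace_curv_eigen ?mulrA //; exact: Be.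
    have S1 := smoothM Uo a_smooth (Ws r s); have S2 := smoothM Uo fs (Ts r s).
    rewrite (partialB Uo) //; last by apply: smoothM => //; exact: smooth_cst.
    rewrite (@partialM _ U _ (fun=> 4)) //; last exact: smooth_cst.
    rewrite partial_cst mul0r add0r (partialM p a_smooth (Ws r s) Ux) (partialM p fs (Ts r s) Ux).
    rewrite -(dmxE p W x r s) -(dmxE p T x r s).
    by rewrite /W /T Bx.
  move: H1; rewrite H2 trace_curv_eigen // dW dT (addmxE (G x *m E p *m G x)).
  rewrite (addmxE (tau (E p) x + _)) (addmxE (tau (E p) x)).
  move: (\tr _) (G x *m E p *m G x) (tau (E p) x) => u1 u2 u3 E1.
  by apply: (addIr (4 * a x * u2 r s - f x * u3 r s)); rewrite -E1; ring.
have Z : \tr (D m i j *m G x *m K) + \tr (D i j m *m G x *m K) + \tr (D j m i *m G x *m K) = 0.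
  by rewrite -!linearD -!mulmxDl /= (bianchi2 Uo Gs Gu m i j Ux) !mul0mx linear0.
have tT : (tau K x)^T = - tau K x.
  by rewrite /tau linearD /= !trmx_mul hessian_sym // GT // KT !mulmxA !(mulNmx, mulmxN); mxlin.
have C1 := conn_cyclic i m j Ux (sandwich_skew Ux KT).
have C2 := conn_cyclic i m j Ux tT.
pose q r p s := (G x *m K *m H p) r s.
have HT p : (H p)^T = H p.
  have dhT : (dmx p h x)^T = dmx p h x.
    by rewrite -dmx_tr; apply: (dmx_eq Uo) Ux; exact: hessian_sym.
  by rewrite /H !linearB /= !trmx_mul trmxK hessian_sym // dhT; mxlin.
have qE p r s : (G x *m K *m H p + H p *m K *m G x) r s = q r p s - q s p r.
  have -> : H p *m K *m G x = - (G x *m K *m H p)^T.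
    by rewrite !trmx_mul HT GT // KT mulNmx mulmxN opprK mulmxA.
  by rewrite addmxE oppmxE [(_^T) _ _]mxE.
have V := curv_gradient_cyclic i m j Ux Ke.
have cod r p s : q r p s - q r s p =
  - (G x *m K *m (Rm p s x *m G x) *m (N x)^T) r 0 by exact: hessian_codazzi.
(* Scalar bookkeeping: [c1], [c2], [c3] and [e1], [e2], [e3] are Christoffel terms, [Q1], [Q2], [Q3]
   the derivatives of the Hessian, and [V0] the cyclic curvature term. *)
have fin (A0 F w1 w2 w3 t1 t2 t3 d1 d2 d3 p1 p2 p3 c1 c2 c3 e1 e2 e3 Q1 Q2 Q3 V0 : R) :
    (4 * p1 * w1 - d1 * t1 + 4 * A0 * c1 - F * e1 - F * Q1)
    + (4 * p2 * w2 - d2 * t2 + 4 * A0 * c2 - F * e2 - F * Q2)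
    + (4 * p3 * w3 - d3 * t3 + 4 * A0 * c3 - F * e3 - F * Q3) = 0 ->
    c1 + c2 + c3 = 0 -> e1 + e2 + e3 = 0 -> Q1 + Q2 + Q3 = - V0 ->
    V0 = 4 * A0 * (d1 * w1 + d2 * w2 + d3 * w3) - F / 2 * (d1 * t1 + d2 * t2 + d3 * t3) ->
    4 * (p1 + A0 * F * d1) * w1 + 4 * (p2 + A0 * F * d2) * w2 + 4 * (p3 + A0 * F * d3) * w3
    = (1 + F ^+ 2 / 2) * (d1 * t1 + d2 * t2 + d3 * t3).
  move=> Z0 c0 e0 q0 v0.
  have C : c1 = - c2 - c3 by lra.
  have E0 : e1 = - e2 - e3 by lra.
  have Q0 : Q1 = - V0 - Q2 - Q3 by lra.
  move: Z0; rewrite C E0 Q0 => Z0.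
  by apply/eqP; rewrite -subr_eq0; apply/eqP; rewrite -Z0 v0; field.
rewrite !L in Z; apply: fin Z C1 C2 _ V.
rewrite !qE; move: (cod i m j) (cod j i m) (cod m j i).
move: (q i m j) (q i j m) (q j i m) (q j m i) (q m j i) (q m i j) => k1 k2 k3 k4 k5 k6.
move: ((_ *m _) _ _) ((_ *m _) _ _) ((_ *m _) _ _) => v1 v2 v3 E1 E2 E3.
by lra.
Qed.

End SolitonEquation.

(** * Linear algebra in a null frame *)

Section TriForm.
Context {R : realType}.
Implicit Types (b d : 'rV[R]_4) (w Q : 'M[R]_4).

Definition wedge3 b w i j k : R := b 0 i * w j k + b 0 j * w k i + b 0 k * w i j.

Lemma wedge3_congr b w Q p q r : wedge3 (b *m Q^T) (Q *m w *m Q^T) p q r =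
  \sum_i \sum_j \sum_k Q p i * Q q j * Q r k * wedge3 b w i j k.
Proof.
rewrite /wedge3.
have E0 s : (b *m Q^T) 0 s = \sum_i Q s i * b 0 i.
  by rewrite mxE; apply: eq_bigr => i _; rewrite mxE mulrC.
have E1 s u : (Q *m w *m Q^T) s u = \sum_j \sum_k Q s j * Q u k * w j k.
  rewrite mxE exchange_big; apply: eq_bigr => k _; rewrite !mxE mulr_suml.
  by apply: eq_bigr => j _; ring.
rewrite !E0 !E1 !sum4.
clear E0 E1; move: (Q p) (Q q) (Q r) (b 0) w => f g h b' w'.
by ring.
Qed.

Lemma wedge3_eq_congr b w d s c Q : (forall i j k, wedge3 b w i j k = c * wedge3 d s i j k) ->
  forall p q r, wedge3 (b *m Q^T) (Q *m w *m Q^T) p q r =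
    c * wedge3 (d *m Q^T) (Q *m s *m Q^T) p q r.
Proof.
move=> E p q r; rewrite !wedge3_congr mulr_sumr; apply: eq_bigr => i _.
rewrite mulr_sumr; apply: eq_bigr => j _; rewrite mulr_sumr; apply: eq_bigr => k _.
by rewrite E mulrCA.
Qed.

End TriForm.

(** * A frame adapted to the null gradient, and the linear system in it *)

Section Frame.
Context {R : realType}.
Implicit Types (G K Q h : 'M[R]_4).

Definition eta4 : 'M[R]_4 := diag_mx (\row_(i < 4) (if (i < 2)%N then -1 else 1)).

Lemma etaE : eta4 = nat_mx (fun i j => if i == j then (if (i < 2)%N then -1 else 1) else 0).
Proof.
apply/matrixP => i j; rewrite !mxE -val_eqE; case: (_ == _); by rewrite ?mulr1n ?mulr0n.
Qed.

Definition null_row : 'rV[R]_4 := row 0 (nat_mx (fun _ j => nth 0 [:: 1; 0; 1; 0] j)).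

(** Nullity means that the negative and positive parts of the vector have the same squared length
    [r], so a conformal rotation in each of the two definite planes brings it to [null_row]. Keeping
    the factor [r] avoids normalizing by a square root. *)
Lemma null_frame G (N : 'rV[R]_4) P : P \in unitmx -> P *m G *m P^T = eta4 ->
  N != 0 -> N *m G *m N^T = 0 ->
  exists Q (r : R), [/\ Q \in unitmx, 0 < r, Q *m G *m Q^T = r *: eta4 & N = null_row *m Q].
Proof.
move=> Pu PG N0 NG.
pose v := N *m invmx P; have vN : N = v *m P by rewrite mulmxKV.
clearbody v; pose x j := v 0 (inord j).
have vE : v = row 0 (nat_mx (fun _ j => x j)).
  by apply/rowP => j; rewrite !mxE /x inord_val.
(* The two blocks are multiplication by the complex numbers x0 + i x1 and x2 + i x3. *)
pose Rot := nat_mx (fun i j => nth 0 (nth [::] [::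
  [:: x 0%N; x 1%N; 0; 0]; [:: - x 1%N; x 0%N; 0; 0];
  [:: 0; 0; x 2%N; x 3%N]; [:: 0; 0; - x 3%N; x 2%N]] i) j).
pose r := x 0%N ^+ 2 + x 1%N ^+ 2.
have rE : x 2%N ^+ 2 + x 3%N ^+ 2 = r.
  have : v *m eta4 *m v^T = 0 by rewrite -PG !mulmxA -vN -mulmxA -trmx_mul -vN.
  move/matrixP/(_ 0 0); rewrite vE etaE -row_mul nat_mxM mxE [RHS]mxE sum4 !mxE /=.
  by rewrite /r; lra.
have vnR : null_row *m Rot = v.
  rewrite vE /null_row /Rot -row_mul nat_mxM; congr row.
  by apply: nat_mx_eq => i; case=> [|[|[|[|?]]]] //= _ _; ring.
have RR : Rot *m eta4 *m Rot^T = r *: eta4.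
  rewrite /Rot etaE; entries4; rewrite ?mulr0 ?mul0r ?addr0 ?add0r ?oppr0; try by rewrite /r; ring.
  - by rewrite mulr1 -rE; ring.
  - by rewrite mulr1 -rE; ring.
have r0 : 0 < r.
  rewrite lt_neqAle addr_ge0 ?sqr_ge0 // andbT eq_sym; apply/eqP => rz.
  move: (rz); rewrite /r => /eqP; rewrite paddr_eq0 ?sqr_ge0 // !sqrf_eq0 => /andP[/eqP x0 /eqP x1].
  move: rE; rewrite rz => /eqP; rewrite paddr_eq0 ?sqr_ge0 // !sqrf_eq0 => /andP[/eqP x2 /eqP x3].
  move/eqP: N0; apply; rewrite vN vE (_ : nat_mx _ = 0) ?row0 ?mul0mx //.
  apply/matrixP => i j; rewrite !mxE; move: j; exact: ord4P.
exists (Rot *m P), r; split => //.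
- have eta_u : \det eta4 != 0.
    rewrite det_diag; apply/prodf_neq0 => i _; rewrite mxE; case: ifP => _;
      by rewrite ?oppr_eq0 oner_eq0.
  rewrite unitmx_mul Pu andbT unitmxE unitfE.
  have : \det (Rot *m eta4 *m Rot^T) != 0.
    by rewrite RR detZ mulf_neq0 // expf_neq0 // gt_eqF.
  by rewrite !det_mulmx !mulf_eq0 !negb_or => /andP[/andP[]].
- by rewrite trmx_mul !mulmxA -(mulmxA Rot P) -(mulmxA Rot (P *m G)) PG.
- by rewrite mulmxA vnR.
Qed.

(* The bivectors of a Hodge eigenspace in a frame with Gram matrix [eta4]; the sign [e]
   combines the eigenvalue with the orientation of the frame. *)
Definition frame_form (e a b c : R) : 'M[R]_4 := skew6 a b c (- (e * c)) (e * b) (e * a).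

Lemma eta_nat_mx (m : nat -> nat -> R) :
  eta4 *m nat_mx m = nat_mx (fun i j => if (i < 2)%N then - m i j else m i j).
Proof.
rewrite etaE nat_mxM; apply: nat_mx_eq.
by case=> [|[|[|[|?]]]]; case=> [|[|[|[|?]]]] //= _ _; ring.
Qed.

Lemma nat_mx_eta (m : nat -> nat -> R) :
  nat_mx m *m eta4 = nat_mx (fun i j => if (j < 2)%N then - m i j else m i j).
Proof.
rewrite etaE nat_mxM; apply: nat_mx_eq.
by case=> [|[|[|[|?]]]]; case=> [|[|[|[|?]]]] //= _ _; ring.
Qed.

Lemma frame_formP e a b c : e ^+ 2 = 1 ->
  eta4 *m frame_form e a b c *m eta4 = e *: dual4 (frame_form e a b c).
Proof.
move=> e1; rewrite /frame_form dual4_skew6 skew6Z /skew6 eta_nat_mx nat_mx_eta.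
by apply: nat_mx_eq; case=> [|[|[|[|?]]]]; case=> [|[|[|[|?]]]] //= _ _;
  rewrite ?(mulrN, opprK, mulrA) -?expr2 ?e1 ?mul1r ?mulr0 ?oppr0.
Qed.

Lemma frame_form_ex e K : e ^+ 2 = 1 -> K^T = - K -> eta4 *m K *m eta4 = e *: dual4 K ->
  exists a b c, K = frame_form e a b c.
Proof.
move=> e1 /skew6P [a [b [c [d [f [g ->]]]]]] H; exists a, b, c.
move: H; rewrite dual4_skew6 skew6Z [in eta4 *m _]/skew6 eta_nat_mx nat_mx_eta => /matrixP H.
have := (H (ord4 1) (ord4 2), H (ord4 1) (ord4 3), H (ord4 2) (ord4 3)).
rewrite !mxE /= => -[[H1 H2] H3].
by rewrite /frame_form; congr skew6; lra.
Qed.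

(** The conclusion says that [h] annihilates (1,0,1,0) and (0,1,0,-e), which span the plane of all J
    N. The first vector is [null_row] itself; the second comes from eliminating [b] from the 3-form
    equations. *)
Lemma frame_linear e (b : 'rV[R]_4) h : e ^+ 2 = 1 -> h^T = h -> h *m null_row^T = 0 ->
  (forall x y z i j k, let K := frame_form e x y z in
    wedge3 b (eta4 *m K *m eta4) i j k =
    wedge3 (null_row *m eta4) (eta4 *m K *m h + h *m K *m eta4) i j k) ->
  forall i, h i (ord4 2) = - h i (ord4 0) /\ h i (ord4 1) = e * h i (ord4 3).
Proof.
move=> e1 hT hN H.
have hS i j : h i j = h j i by rewrite -[in LHS]hT mxE.
have h2 i : h i (ord4 2) = - h i (ord4 0).
  move/matrixP/(_ i 0) : hN; rewrite mxE sum4 !mxE /= => E; lra.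
have [m hm] := nat_mxP h.
have nE : null_row *m eta4 = row 0 (nat_mx (fun _ j => nth 0 [:: -1; 0; 1; 0] j)).
  rewrite /null_row -row_mul nat_mx_eta; congr row; apply: nat_mx_eq => i.
  by case=> [|[|[|[|?]]]] //= _ _; rewrite oppr0.
have S i j : (i < 4)%N -> (j < 4)%N -> m i j = m j i.
  by move=> Hi Hj; have := hS (Ordinal Hi) (Ordinal Hj); rewrite hm !mxE.
have T i : (i < 4)%N -> m i 2%N = - m i 0%N.
  by move=> Hi; have := h2 (Ordinal Hi); rewrite hm !mxE.
have F x y z i j k := H x y z i j k.
rewrite hm nE /frame_form /= in F.
(* The three basis forms of the eigenspace, each evaluated below on the four increasing triples of
   indices. *)
have F1 := F 1 0 0; have F2 := F 0 1 0; have F3 := F 0 0 1; clear F H.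
rewrite /skew6 eta_nat_mx !nat_mxM !nat_mx_eta !nat_mxD /wedge3 in F1.
rewrite /skew6 eta_nat_mx !nat_mxM !nat_mx_eta !nat_mxD /wedge3 in F2.
rewrite /skew6 eta_nat_mx !nat_mxM !nat_mx_eta !nat_mxD /wedge3 in F3.
have nat_mxE g i j : nat_mx g i j = g i j :> R by rewrite mxE.
have nat_rowE g i j : row 0 (nat_mx g) i j = g 0%N j :> R by rewrite !mxE.
(* Fixing the sign of [e] makes the twelve equations linear in [b] and [h], within reach of
   [lra]. *)
have e_cases : e = 1 \/ e = -1.
  by move/eqP: e1; rewrite sqrf_eq1 => /orP[] /eqP ->; [left|right].
have S10 := S 1%N 0%N isT isT.
have S20 := S 2%N 0%N isT isT.
have S30 := S 3%N 0%N isT isT.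
have S21 := S 2%N 1%N isT isT.
have S31 := S 3%N 1%N isT isT.
have S32 := S 3%N 2%N isT isT.
have T0 := T 0%N isT.
have T1 := T 1%N isT.
have T2 := T 2%N isT.
have T3 := T 3%N isT.
have G11 := F1 (ord4 0) (ord4 1) (ord4 2); rewrite !nat_mxE !nat_rowE /= in G11.
have G12 := F1 (ord4 0) (ord4 1) (ord4 3); rewrite !nat_mxE !nat_rowE /= in G12.
have G13 := F1 (ord4 0) (ord4 2) (ord4 3); rewrite !nat_mxE !nat_rowE /= in G13.
have G14 := F1 (ord4 1) (ord4 2) (ord4 3); rewrite !nat_mxE !nat_rowE /= in G14.
have G21 := F2 (ord4 0) (ord4 1) (ord4 2); rewrite !nat_mxE !nat_rowE /= in G21.
have G22 := F2 (ord4 0) (ord4 1) (ord4 3); rewrite !nat_mxE !nat_rowE /= in G22.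
have G23 := F2 (ord4 0) (ord4 2) (ord4 3); rewrite !nat_mxE !nat_rowE /= in G23.
have G24 := F2 (ord4 1) (ord4 2) (ord4 3); rewrite !nat_mxE !nat_rowE /= in G24.
have G31 := F3 (ord4 0) (ord4 1) (ord4 2); rewrite !nat_mxE !nat_rowE /= in G31.
have G32 := F3 (ord4 0) (ord4 1) (ord4 3); rewrite !nat_mxE !nat_rowE /= in G32.
have G33 := F3 (ord4 0) (ord4 2) (ord4 3); rewrite !nat_mxE !nat_rowE /= in G33.
have G34 := F3 (ord4 1) (ord4 2) (ord4 3); rewrite !nat_mxE !nat_rowE /= in G34.
have key : [/\ m 0%N 1%N = e * m 0%N 3%N, m 1%N 1%N = e * m 1%N 3%N & m 1%N 3%N = e * m 3%N 3%N].
  clear F1 F2 F3 hT hN hS h2 nE S T.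
  move: G11 G12 G13 G14 G21 G22 G23 G24 G31 G32 G33 G34.
  case: e_cases => -> *; split; lra.
have [K0 K1 K3] := key.
move=> i; split; first exact: h2.
move: i; apply: ord4P; rewrite hm !nat_mxE /=.
- by rewrite K0.
- by rewrite K1.
- by rewrite S21 T1 -S32 T3 S10 S30 K0 mulrN.
- by rewrite S31 K3.
Qed.

End Frame.

Section Conclusion.
Context {R : realType}.
Implicit Types (G K Q h : 'M[R]_4).

Lemma eta_sq : eta4 *m eta4 = 1%:M :> 'M[R]_4.
Proof.
rewrite etaE nat_mxM nat_mx_scalar; apply: nat_mx_eq.
by case=> [|[|[|[|?]]]]; case=> [|[|[|[|?]]]] //= _ _; ring.
Qed.

Lemma det_eta : \det (eta4 : 'M[R]_4) = 1.
Proof. by rewrite etaE det4 /=; ring. Qed.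

(** Everything is transported to the adapted frame and solved by [frame_linear]. The trace vanishes
    because the relations equate the diagonal entries 0 and 2, and 1 and 3, which [eta4] counts with
    opposite signs. *)
Lemma eigen_null_gradient G (t : R) P (N b : 'rV[R]_4) h (c : R) :
  G \in unitmx -> G^T = G -> t ^+ 2 = \det G -> P \in unitmx -> P *m G *m P^T = eta4 ->
  N != 0 -> N *m G *m N^T = 0 -> h^T = h -> h *m N^T = 0 -> 0 < c ->
  (forall K, dual_eigen t G K -> forall i j k,
     wedge3 b (G *m K *m G) i j k =
     c * wedge3 (N *m G) (G *m K *m h + h *m K *m G) i j k) ->
  [/\ forall K, dual_eigen t G K -> N *m G *m K *m h = 0,
      metric_trace G h = 0 &
      exists2 K, dual_eigen t G K & \tr (G *m K *m G *m K) < 0].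
Proof.
move=> Gu GT tG Pu PG N0 NG hT hN c0 HE.
have [Q [r [Qu r0 QG NQ]]] := null_frame Pu PG N0 NG.
have rn0 : r != 0 by rewrite gt_eqF.
have QuT : Q^T \in unitmx by rewrite unitmx_tr.
(* Passing to the frame [Q] multiplies [dual4] by [\det Q] and the two metric factors by [r ^+ 2];
   what is left of [t] is a sign. *)
pose e := t * \det Q / r ^+ 2.
have e1 : e ^+ 2 = 1.
  have : \det (Q *m G *m Q^T) = r ^+ 4 by rewrite QG detZ det_eta mulr1.
  rewrite !det_mulmx det_tr -tG => E.
  apply: (mulIf (expf_neq0 4 rn0)); rewrite mul1r -[RHS]E /e; field.
  exact: rn0.
have conj K : Q *m (G *m (Q^T *m K *m Q) *m G) *m Q^T = r ^+ 2 *: (eta4 *m K *m eta4).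
  have -> : Q *m (G *m (Q^T *m K *m Q) *m G) *m Q^T = (Q *m G *m Q^T) *m K *m (Q *m G *m Q^T).
    by rewrite !mulmxA.
  by rewrite QG -!(scalemxAl, scalemxAr) scalerA expr2.
have eig K : K^T = - K -> (dual_eigen t G (Q^T *m K *m Q) <->
    eta4 *m K *m eta4 = e *: dual4 K).
  move=> KT; have skew : (Q^T *m K *m Q)^T = - (Q^T *m K *m Q).
    by rewrite !trmx_mul trmxK KT mulNmx mulmxN mulmxA.
  have D := dual4_congr Q^T KT; rewrite !trmxK det_tr in D.
  have T : Q *m (t *: dual4 (Q^T *m K *m Q)) *m Q^T = r ^+ 2 *: (e *: dual4 K).
    rewrite -scalemxAr -scalemxAl D !scalerA /e; congr (_ *: _); field.
    exact: rn0.
  split=> [[_ E]|E].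
    by apply: (scalerI (expf_neq0 2 rn0)); rewrite -T -E conj.
  split=> //; apply: (can_inj (mulKmx Qu)); apply: (can_inj (mulmxK QuT)).
  by rewrite conj T E.
have Qsurj K : K^T = - K -> exists2 K', K'^T = - K' & K = Q^T *m K' *m Q.
  move=> KT; exists (invmx Q^T *m K *m invmx Q).
    by rewrite !trmx_mul !trmx_inv trmxK KT mulNmx mulmxN mulmxA.
  by rewrite !mulmxA mulmxV // mul1mx mulmxKV.
pose h' := c *: (Q *m h *m Q^T).
have lin : forall i, h' i (ord4 2) = - h' i (ord4 0) /\ h' i (ord4 1) = e * h' i (ord4 3).
  apply: (frame_linear (b := b *m Q^T) e1).
  - by rewrite /h' linearZ /= !trmx_mul trmxK hT mulmxA.
  - by rewrite /h' -scalemxAl -!mulmxA -trmx_mul -NQ hN mulmx0 scaler0.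
  move=> x y z i j k K.
  have Ke : dual_eigen t G (Q^T *m K *m Q).
    by apply/eig; [exact: skew6_skew|exact: frame_formP].
  have := wedge3_eq_congr Q (HE _ Ke) i j k; rewrite conj.
  have -> : N *m G *m Q^T = r *: (null_row *m eta4).
    by rewrite NQ -!mulmxA (mulmxA Q) QG -scalemxAr.
  have -> : Q *m (G *m (Q^T *m K *m Q) *m h + h *m (Q^T *m K *m Q) *m G) *m Q^T =
      (r / c) *: (eta4 *m K *m h' + h' *m K *m eta4).
    rewrite mulmxDr mulmxDl.
    have -> : Q *m (G *m (Q^T *m K *m Q) *m h) *m Q^T = (Q *m G *m Q^T) *m K *m (Q *m h *m Q^T).
      by rewrite !mulmxA.
    have -> : Q *m (h *m (Q^T *m K *m Q) *m G) *m Q^T = (Q *m h *m Q^T) *m K *m (Q *m G *m Q^T).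
      by rewrite !mulmxA.
    rewrite QG /h' -!(scalemxAl, scalemxAr) scalerDr !scalerA.
    by rewrite mulfVK ?gt_eqF.
  have w3 s u (v : 'rV[R]_4) w : wedge3 (s *: v) (u *: w) i j k = s * u * wedge3 v w i j k.
    by rewrite /wedge3 !scalemxE; ring.
  rewrite -[b *m Q^T]scale1r !w3 mul1r scale1r mulrA => E.
  apply: (mulfI (expf_neq0 2 rn0)); rewrite E; congr (_ * _); field.
  by rewrite gt_eqF.
have cn0 : c != 0 by rewrite gt_eqF.
have hE : Q *m h *m Q^T = c^-1 *: h' by rewrite /h' scalerA mulVf // scale1r.
have hS i j : h' i j = h' j i.
  have : h'^T = h' by rewrite /h' linearZ /= !trmx_mul trmxK hT mulmxA.
  by move/matrixP/(_ i j); rewrite mxE.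
clearbody h'; split.
- move=> K Ke; have [KT _] := Ke; have [K' KT' KE] := Qsurj K KT.
  have [x [y [z K'E]]] := frame_form_ex e1 KT' ((eig K' KT').1 (eq_ind _ (dual_eigen t G) Ke _ KE)).
  apply: (can_inj (mulmxK QuT)); rewrite mul0mx KE.
  have -> : N *m G *m (Q^T *m K' *m Q) *m h *m Q^T = (N *m G *m Q^T) *m K' *m (Q *m h *m Q^T).
    by rewrite !mulmxA.
  have -> : N *m G *m Q^T = r *: (null_row *m eta4).
    by rewrite NQ -!mulmxA (mulmxA Q) QG -scalemxAr.
  rewrite hE -!(scalemxAl, scalemxAr) scalerA.
  have -> : null_row *m eta4 *m K' *m h' = 0; last by rewrite scaler0.
  apply/rowP => i; have [E2 E1] := lin i.
  rewrite [RHS]mxE [LHS]mxE sum4 !(hS _ i) E1 E2 K'E.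
  rewrite /frame_form /skew6 /null_row -!row_mul nat_mx_eta nat_mxM.
  rewrite !mxE /=.
  move: (h' i (ord4 0)) (h' i (ord4 3)) => h0 h3.
  apply: (etrans (_ : _ = (e ^+ 2 - 1) * z * h3)); last by rewrite e1 subrr !mul0r.
  by ring.
- rewrite /metric_trace.
  have hE2 : h = c^-1 *: (invmx Q *m h' *m invmx Q^T).
    apply: (can_inj (mulKmx Qu)); apply: (can_inj (mulmxK QuT)).
    by rewrite hE -!(scalemxAl, scalemxAr) !mulmxA mulmxV // mul1mx mulmxKV.
  have GE : invmx G = r^-1 *: (Q^T *m eta4 *m Q).
    have : G *m (r^-1 *: (Q^T *m eta4 *m Q)) = 1%:M.
      apply: (can_inj (mulKmx Qu)); rewrite mulmx1 -!scalemxAr !mulmxA QG -!scalemxAl.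
      by rewrite scalerA mulVf // scale1r eta_sq mul1mx.
    by move/(congr1 (mulmx (invmx G))); rewrite mulKmx // mulmx1 => <-.
  rewrite GE {1}hE2 -!(scalemxAl, scalemxAr) !mulmxA mulmxK // !mxtraceZ mxtrace_mulC !mulmxA.
  rewrite mulVmx // mul1mx.
  have [m hm] := nat_mxP h'.
  have -> : \tr (eta4 *m h') =
      - h' (ord4 0) (ord4 0) - h' (ord4 1) (ord4 1) + h' (ord4 2) (ord4 2) + h' (ord4 3) (ord4 3).
    by rewrite hm eta_nat_mx nat_mx_trace !mxE.
  have [E02 E01] := lin (ord4 0); have [E12 E11] := lin (ord4 1).
  have [E22 E21] := lin (ord4 2); have [E32 E31] := lin (ord4 3).
  have -> : h' (ord4 2) (ord4 2) = h' (ord4 0) (ord4 0) by rewrite E22 hS E02 opprK.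
  have -> : h' (ord4 1) (ord4 1) = h' (ord4 3) (ord4 3) by rewrite E11 hS E31 mulrA -expr2 e1 mul1r.
  by rewrite (_ : _ - _ + _ + _ = 0) ?mulr0 //; ring.
(* This form rotates each of the two definite planes, so its endomorphism has negative square; the
   other two basis forms mix the planes and have positive square. *)
exists (Q^T *m frame_form e 1 0 0 *m Q).
  by apply/eig; [exact: skew6_skew|exact: frame_formP].
have -> : \tr (G *m (Q^T *m frame_form e 1 0 0 *m Q) *m G *m (Q^T *m frame_form e 1 0 0 *m Q)) =
    \tr ((Q *m G *m Q^T) *m frame_form e 1 0 0 *m (Q *m G *m Q^T) *m frame_form e 1 0 0).
  by rewrite !mulmxA [LHS]mxtrace_mulC !mulmxA.
rewrite QG -!(scalemxAl, scalemxAr) !mxtraceZ.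
have -> : \tr (eta4 *m frame_form e 1 0 0 *m eta4 *m frame_form e 1 0 0) = -2 * (1 + e ^+ 2).
  by rewrite /frame_form /skew6 eta_nat_mx nat_mx_eta nat_mxM nat_mx_trace /=; ring.
rewrite e1 mulrA -expr2 pmulr_rlt0 ?exprn_gt0 //.
Qed.

End Conclusion.

(** * The parallel null plane *)

Section SelfDualWeyl.
Context {R : realType} (U : set 'rV[R]_4) (Uo : open U) (G : 'rV[R]_4 -> 'M[R]_4).
Hypotheses (Gs : smooth_mx U G) (GT : forall x, U x -> (G x)^T = G x)
  (Gu : forall x, U x -> G x \in unitmx).
Variables (f lam : 'rV[R]_4 -> R).
Hypotheses (fs : smooth_on U f)
  (sol : forall x, U x -> ricci G x + f x *: hessian G f x = lam x *: G x).
Implicit Types (i j k l : 'I_4).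

(** Symmetry is read off from the soliton equation, the metric and the Hessian being symmetric. *)
Lemma ricci_sym x : U x -> (ricci G x)^T = ricci G x.
Proof.
move=> Ux; have hT := hessian_sym Uo GT fs Ux.
by rewrite (ricci_soliton sol Ux) linearB /= !linearZ /= GT // hT.
Qed.

Lemma weyl_pair x i j k l : U x -> weyl G x i j k l = weyl G x k l i j.
Proof.
move=> Ux; have rS p q : ricci G x p q = ricci G x q p by rewrite -[in LHS]ricci_sym // mxE.
have gS p q : G x p q = G x q p by rewrite -[in LHS]GT // mxE.
rewrite /weyl !riemannE (curv_pair Uo Gs GT Gu) //.
rewrite (rS l i) (rS l j) (rS k i) (rS k j) (gS l i) (gS l j) (gS k i) (gS k j).
move: (scalar_curvature G x) (ricci G x) (G x) (curv_mx G k l x *m G x) => s r g c.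
by field.
Qed.

Lemma weyl_skew x i j k l : U x -> weyl G x i j k l = - weyl G x j i k l.
Proof.
move=> Ux; rewrite /weyl !riemannE curv_mxN mulNmx oppmxE.
move: (scalar_curvature G x) (ricci G x) (G x) (curv_mx G j i x *m G x) => s r g c.
by field.
Qed.

Lemma weyl_mx_skew x i j : U x -> (weyl_mx G x i j)^T = - weyl_mx G x i j.
Proof.
move=> Ux; apply/matrixP => k l; rewrite !mxE weyl_pair // weyl_skew //.
by rewrite -weyl_pair.
Qed.

(** This is a coordinate bivector with lowered indices. The order of [k] and [l] matches the
    reversed last pair in [weyl_op], so no sign appears in [weyl_op_elementary]. *)
Definition elementary_form x k l : 'M[R]_4 :=
  G x *m (delta_mx l k - delta_mx k l) *m G x.

Lemma elementary_form_skew x k l : U x -> two_form (elementary_form x k l).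
Proof.
move=> Ux; rewrite /two_form /elementary_form !trmx_mul GT // linearB /= !trmx_delta mulmxA.
by rewrite -mulNmx -mulmxN opprB.
Qed.

Lemma weyl_op_elementary x k l : U x ->
  weyl_op G x (elementary_form x k l) = weyl_mx G x k l.
Proof.
move=> Ux; have rE : raise2 (G x) (elementary_form x k l) = delta_mx l k - delta_mx k l.
  rewrite /raise2 (invmxT GT) // /elementary_form !mulmxA mulVmx ?Gu // mul1mx.
  by rewrite mulmxK ?Gu.
apply/matrixP => i j; rewrite !mxE rE.
have S p q : \sum_a \sum_b weyl G x i j b a * (delta_mx p q : 'M[R]_4) a b = weyl G x i j q p.
  rewrite (bigD1 p) //= [X in _ + X]big1 ?addr0 => [|a ap].
    rewrite (bigD1 q) //= big1 ?addr0 => [|b bq]; first by rewrite mxE !eqxx mulr1.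
    by rewrite mxE (negbTE bq) andbF mulr0.
  by rewrite big1 // => b _; rewrite mxE (negbTE ap) mulr0.
have -> : \sum_a \sum_b weyl G x i j b a * (delta_mx l k - delta_mx k l : 'M[R]_4) a b =
    weyl G x i j k l - weyl G x i j l k.
  rewrite -!S -sumrB; apply: eq_bigr => a _; rewrite -sumrB; apply: eq_bigr => b _.
  by rewrite addmxE oppmxE mulrBr.
rewrite (weyl_pair i j l k) // (weyl_skew l k) // -(weyl_pair i j) // -weyl_pair //.
by field.
Qed.

(** Every [weyl_mx G x i j] is a value of the Weyl operator, by pair symmetry, so the vanishing of
    one half makes it an eigenvector of the Hodge star. The outer minus sign is kept so that the
    number inside it selects the complementary eigenspace, on which the argument works. *)
Lemma weyl_eigen o (b : bool) x i j : U x ->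
  (forall w, two_form w ->
     (if b then weyl_plus o G x w else weyl_minus o G x w) = 0) ->
  dual_eigen (- ((-1) ^+ b * ((-1) ^+ (~~ o) * Num.sqrt `|\det (G x)|))) (G x)
    (invmx (G x) *m weyl_mx G x i j *m invmx (G x)).
Proof.
move=> Ux H; have iT := invmxT GT Ux; have WT := weyl_mx_skew i j Ux.
split; first by rewrite !trmx_mul iT WT mulNmx mulmxN mulmxA.
have -> : G x *m (invmx (G x) *m weyl_mx G x i j *m invmx (G x)) *m G x = weyl_mx G x i j.
  by rewrite !mulmxA mulmxV ?Gu // mul1mx mulmxKV // Gu.
have := H _ (elementary_form_skew i j Ux).
rewrite /weyl_plus /weyl_minus weyl_op_elementary // hodge_starE ?GT //.
have half (M : 'M[R]_4) : 2^-1 *: M = 0 -> M = 0.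
  by move/eqP; rewrite scaler_eq0 invr_eq0 pnatr_eq0 /= => /eqP.
case: b {H} => /half /eqP; rewrite ?addr_eq0 ?subr_eq0 => /eqP E; rewrite {1}E;
  case: o {E} => /=; rewrite ?expr0 ?expr1 ?mul1r ?mulN1r ?scaleNr ?opprK //.
Qed.

End SelfDualWeyl.

Section NullPlane.
Context {R : realType}.

(** A null plane lies in its orthogonal complement, and in dimension four both have rank 2, so they
    coincide. *)
Lemma null_plane_orthogonal (G : 'M[R]_4) (C : 'M[R]_(2, 4)) (z : 'rV[R]_4) :
  G \in unitmx -> \rank C = 2%N -> C *m G *m C^T = 0 -> z *m G *m C^T = 0 -> (z <= C)%MS.
Proof.
move=> Gu rC CC zC.
have sub : (C <= kermx (G *m C^T))%MS by apply/sub_kermxP; rewrite mulmxA.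
have rk : \rank (kermx (G *m C^T)) = 2%N.
  rewrite mxrank_ker -[X in (_ - X)%N]mxrank_tr trmx_mul trmxK.
  by rewrite mxrankMfree ?rC // row_free_unit unitmx_tr.
have := mxrank_leqif_sup sub; rewrite rC rk => -[_ E].
have /submx_trans -> // : (z <= kermx (G *m C^T))%MS by apply/sub_kermxP; rewrite mulmxA.
Qed.

Lemma gram_col_mx (G : 'M[R]_4) (u v y z : 'rV[R]_4) :
  u *m G *m y^T = 0 -> u *m G *m z^T = 0 -> v *m G *m y^T = 0 -> v *m G *m z^T = 0 ->
  col_mx u v *m G *m (col_mx y z)^T = 0.
Proof.
move=> uy uz vy vz; rewrite tr_col_mx !mul_col_mx !mul_mx_row uy uz vy vz.
by rewrite !row_mx0 col_mx0.
Qed.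

(* A real eigenvector of [J] would make [q] a square. *)
Lemma rank_col_mx_square (u : 'rV[R]_4) (J : 'M[R]_4) q :
  u != 0 -> q < 0 -> J *m J = q%:M -> \rank (col_mx u (u *m J)) = 2%N.
Proof.
move=> u0 q0 JJ; apply/eqP; apply: (@inj_row_free _ _ _ (col_mx u (u *m J))) => v.
rewrite -[v]hsubmxK mul_row_col [lsubmx v]mx11_scalar [rsubmx v]mx11_scalar.
move: (lsubmx v 0 0) (rsubmx v 0 0) => a b; rewrite !mul_scalar_mx => E.
have E2 : a *: (u *m J) + b *: (q *: u) = 0.
  have := congr1 (mulmx^~ J) E; rewrite /= mul0mx mulmxDl -!scalemxAl -mulmxA JJ.
  by rewrite mul_mx_scalar.
have : (a ^+ 2 - b ^+ 2 * q) *: u = 0.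
  have := congr1 (fun w => a *: w) E; have := congr1 (fun w => b *: w) E2.
  rewrite /= !scaler0 => F1 F2; rewrite -[RHS](subrr 0) -{1}F2 -F1.
  by mxlin.
move/eqP; rewrite scaler_eq0 (negbTE u0) orbF => /eqP ab.
have b2 : 0 <= b ^+ 2 * - q by rewrite mulr_ge0 ?sqr_ge0 // oppr_ge0 ltW.
have a0 : a ^+ 2 = 0 by have := sqr_ge0 a; lra.
have : b ^+ 2 * - q = 0 by lra.
move/eqP; rewrite mulf_eq0 oppr_eq0 (lt_eqF q0) orbF sqrf_eq0 => /eqP ->.
move/eqP: a0; rewrite sqrf_eq0 => /eqP ->.
by rewrite !raddf0 row_mx0.
Qed.

End NullPlane.

Section Walker.
Context {R : realType} (U : set 'rV[R]_4) (Uo : open U) (G : 'rV[R]_4 -> 'M[R]_4).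
Hypotheses (Gs : smooth_mx U G) (GT : forall x, U x -> (G x)^T = G x)
  (Gu : forall x, U x -> G x \in unitmx).

Lemma cov_orthogonal (Y Z : 'rV[R]_4 -> 'rV[R]_4) i x :
  smooth_mx U Y -> smooth_mx U Z -> (forall y, U y -> Y y *m G y *m (Z y)^T = 0) -> U x ->
  cov G i Y x *m G x *m (Z x)^T + Y x *m G x *m (cov G i Z x)^T = 0.
Proof.
move=> Ys Zs YZ Ux; have := @dmx_eq _ U Uo _ _ i _ _ x YZ Ux; rewrite dmx_cst.
have ZT := smooth_mx_tr Uo Zs; have YG := smooth_mxM Uo Ys Gs.
rewrite !(dmxM Uo) // (dmxG Uo GT Gu) // (dmx_tr _ Z) => <-.
rewrite /cov linearD /= trmx_mul !(mulmxDl, mulmxDr) !mulmxA.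
by mxlin.
Qed.

Variables (f : 'rV[R]_4 -> R) (B : 'rV[R]_4 -> 'M[R]_4).
Hypotheses (fs : smooth_on U f) (Bs : smooth_mx U B)
  (BT : forall x, U x -> (B x)^T = - B x).
Local Notation N := (gradient G f).
Local Notation h := (hessian G f).
Hypotheses (N0 : forall x, U x -> N x != 0) (NN : forall x, U x -> N x *m G x *m (N x)^T = 0)
  (hN : forall x, U x -> h x *m (N x)^T = 0).
Let u x := N x *m G x *m B x.
Hypotheses (hu : forall x, U x -> u x *m h x = 0)
  (sq : forall x, U x -> exists2 q, q < 0 & G x *m B x *m G x *m B x = q%:M).

(** The plane D spanned by N and [u] is its own orthogonal complement, so a derivative is in D as
    soon as it is orthogonal to N and [u]. By [cov_orthogonal] this reduces to the derivatives of N
    and [u] being orthogonal to D. *)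
Lemma walker_span : walker_on U G.
Proof.
have Ns := smooth_gradient Uo Gs Gu fs.
have us : smooth_mx U u by do !apply: smooth_mxM => //.
have tr11 (M : 'M[R]_1) : M^T = M by apply/matrixP => a b; rewrite mxE !ord1.
have trp x (a b : 'rV[R]_4) : U x -> a *m G x *m b^T = b *m G x *m a^T.
  by move=> Ux; rewrite -[LHS]tr11 !trmx_mul trmxK GT // mulmxA.
have Nu x : U x -> N x *m G x *m (u x)^T = 0.
  move=> Ux; have E : N x *m G x *m (u x)^T = - (N x *m G x *m (u x)^T).
    rewrite -[LHS]tr11 !trmx_mul !trmxK GT // BT // /u !(mulmxN, mulNmx) !mulmxA.
    by rewrite opprK.
  by move/eqP: E; rewrite -addr_eq0 -mulr2n -scaler_nat scaler_eq0 pnatr_eq0 => /eqP.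
have uN x : U x -> u x *m G x *m (N x)^T = 0.
  by move=> Ux; rewrite trp // Nu.
have uu x : U x -> u x *m G x *m (u x)^T = 0.
  move=> Ux; have [q _ E] := sq Ux.
  rewrite /u !trmx_mul BT // GT // !(mulmxN, mulNmx) !mulmxA.
  have -> : N x *m G x *m B x *m G x *m B x *m G x *m (N x)^T =
     N x *m (G x *m B x *m G x *m B x) *m G x *m (N x)^T by rewrite !mulmxA.
  by rewrite E mul_mx_scalar -!scalemxAl NN // scaler0 oppr0.
pose C x := col_mx (N x) (u x).
have rC x : U x -> \rank (C x) = 2%N.
  move=> Ux; have [q q0 E] := sq Ux; rewrite /C /u -mulmxA.
  by apply: (rank_col_mx_square (N0 Ux) q0); rewrite mulmxA.
have CC x : U x -> C x *m G x *m (C x)^T = 0.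
  by move=> Ux; apply: gram_col_mx; rewrite ?NN ?Nu ?uN ?uu.
have hC x (y : 'rV[R]_4) : U x -> (y <= C x)%MS -> y *m h x = 0.
  move=> Ux /submxP[c ->]; have hT := hessian_sym Uo GT fs Ux.
  rewrite -mulmxA mul_col_mx hu // (_ : N x *m h x = 0) ?col_mx0 ?mulmx0 //.
  by apply: (can_inj (@trmxK _ _ _)); rewrite trmx_mul hT hN // trmx0.
(* The generated space turns the 2 by 4 matrix [C x] into a square one with the same row space. *)
exists (fun x => <<C x>>%MS); split.
- move=> x Ux; split; first by rewrite mxrank_gen rC.
  exists U, N, u; split=> //; first by split=> i; [exact: Ns|exact: us].
  by move=> y Uy; apply/eqmxP; exact: genmxE.
- move=> x Ux y z; rewrite !genmxE => /submxP[c ->] /submxP[d ->].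
  rewrite /inner trmx_mul.
  have -> : c *m C x *m G x *m ((C x)^T *m d^T) = c *m (C x *m G x *m (C x)^T) *m d^T.
    by rewrite !mulmxA.
  by rewrite CC // mulmx0 mul0mx mxE.
- move=> X Y _ Ys YD x Ux; rewrite genmxE levi_civitaE.
  have YC y : U y -> (Y y <= C y)%MS by move=> /YD; rewrite genmxE.
  have Ys' : smooth_mx U Y by move=> a b; rewrite ord1; exact: Ys.
  apply: summx_sub => i _; apply: scalemx_sub.
  have YCC y : U y -> Y y *m G y *m (C y)^T = 0.
    move=> Uy; have /submxP[c ->] := YC y Uy.
    have -> : c *m C y *m G y *m (C y)^T = c *m (C y *m G y *m (C y)^T) by rewrite !mulmxA.
    by rewrite CC // mulmx0.
  have YN y : U y -> Y y *m G y *m (N y)^T = 0.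
    by move=> /YCC; rewrite tr_col_mx mul_mx_row => /eqP; rewrite row_mx_eq0 => /andP[/eqP].
  have Yu y : U y -> Y y *m G y *m (u y)^T = 0.
    by move=> /YCC; rewrite tr_col_mx mul_mx_row => /eqP; rewrite row_mx_eq0 => /andP[_ /eqP].
  (* The derivative of N is the Hessian, whose kernel contains D. *)
  have covN (z : 'rV[R]_4) : (z <= C x)%MS -> z *m G x *m (cov G i N x)^T = 0.
    move=> zC; rewrite -mulmxA -[G x in LHS]GT // -trmx_mul.
    rewrite -(hessian_row Uo Gs GT Gu fs) // rowE trmx_mul (hessian_sym Uo GT fs Ux) mulmxA.
    by rewrite (hC x) // mul0mx.
  have NC : (N x <= C x)%MS by rewrite -addsmxE addsmxSl.
  have uC : (u x <= C x)%MS by rewrite -addsmxE addsmxSr.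
  (* Pairing with N reduces to [covN] by differentiating g(N,u) = 0; pairing with [u] vanishes by
     differentiating g(u,u) = 0. *)
  have covu : Y x *m G x *m (cov G i u x)^T = 0.
    have Z1 : N x *m G x *m (cov G i u x)^T = 0.
      have := cov_orthogonal i Ns us Nu Ux.
      by rewrite [X in X + _]trp // covN // add0r.
    have Z2 : u x *m G x *m (cov G i u x)^T = 0.
      have := cov_orthogonal i us us uu Ux.
      rewrite [X in X + _]trp // -mulr2n -scaler_nat => /eqP.
      by rewrite scaler_eq0 pnatr_eq0 => /eqP.
    have /submxP[c ->] := YC x Ux.
    by rewrite -!mulmxA mul_col_mx !mulmxA Z1 Z2 col_mx0 mulmx0.
  apply: (null_plane_orthogonal (Gu Ux) (rC x Ux) (CC x Ux)).
  have EN := cov_orthogonal i Ys' Ns YN Ux; have Eu := cov_orthogonal i Ys' us Yu Ux.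
  rewrite covN ?YC // addr0 in EN; rewrite covu addr0 in Eu.
  have E : cov G i Y x *m G x *m (col_mx (N x) (u x))^T = 0.
    by rewrite tr_col_mx mul_mx_row EN Eu row_mx0.
  exact: E.
Qed.

End Walker.

(** * Both conclusions on an open set of a chart with a fixed orientation *)

Section Chart.
Context {R : realType} (U : set 'rV[R]_4) (Uo : open U) (G : 'rV[R]_4 -> 'M[R]_4).
Hypotheses (Gs : smooth_mx U G) (GT : forall x, U x -> (G x)^T = G x)
  (Gu : forall x, U x -> G x \in unitmx)
  (Gn : forall x, U x -> exists2 P, P \in unitmx & P *m G x *m P^T = eta4).
Variables (f lam : 'rV[R]_4 -> R).
Hypotheses (fs : smooth_on U f) (ls : smooth_on U lam)
  (sol : forall x, U x -> ricci G x + f x *: hessian G f x = lam x *: G x)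
  (nul : forall x, U x -> inner (G x) (gradient G f x) (gradient G f x) = 0)
  (N0 : forall x, U x -> gradient G f x != 0).
Variables (o b : bool).
Hypothesis Wo : forall x, U x -> forall w, two_form w ->
  (if b then weyl_plus o G x w else weyl_minus o G x w) = 0.

(** The sign selects the eigenspace opposite to the one containing the Weyl tensor, for either
    orientation [o] and whichever half [b] vanishes. *)
Let t x := (-1) ^+ b * ((-1) ^+ (~~ o) * Num.sqrt `|\det (G x)|).

(** [eta4] has two negative entries, hence determinant 1. Positivity is what makes the square root
    in [t] smooth and gives [t x ^+ 2 = \det (G x)]. *)
Lemma neutral_det_gt0 x : U x -> 0 < \det (G x).
Proof.
move=> Ux; have [P Pu E] := Gn Ux.
have : \det (P *m G x *m P^T) = 1 by rewrite E det_eta.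
rewrite !det_mulmx det_tr mulrAC -expr2 => D.
have p0 : 0 < \det P ^+ 2 by rewrite exprn_even_gt0 //= -unitfE -unitmxE.
by rewrite -(pmulr_rgt0 _ p0) D.
Qed.

Lemma smooth_orientation : smooth_on U t.
Proof.
have S : smooth_on U (fun x => Num.sqrt `|\det (G x)|).
  apply: (@smooth_eq _ _ Uo (fun x => Num.sqrt (\det (G x)))).
    by move=> y Uy; rewrite gtr0_norm // neutral_det_gt0.
  by apply: smooth_sqrt => // [x|]; [exact: neutral_det_gt0|exact: smooth_det].
by do 2?[apply: smoothM => //; first exact: smooth_cst].
Qed.

Lemma orientation_sq x : U x -> t x ^+ 2 = \det (G x).
Proof.
move=> Ux; rewrite /t !exprMn !sqrr_sign !mul1r sqr_sqrtr ?normr_ge0 //.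
by rewrite gtr0_norm // neutral_det_gt0.
Qed.

Lemma chart_null_plane x : U x ->
  [/\ forall K, dual_eigen (t x) (G x) K ->
        gradient G f x *m G x *m K *m hessian G f x = 0,
      laplacian G f x = 0 &
      exists2 K, dual_eigen (t x) (G x) K & \tr (G x *m K *m G x *m K) < 0].
Proof.
move=> Ux; have [P Pu PG] := Gn Ux.
have NN : gradient G f x *m G x *m (gradient G f x)^T = 0.
  by apply/matrixP => p q; rewrite !ord1 [RHS]mxE; exact: nul.
pose B : 'rV[R]_4 := \row_m (4 * (partial m (schouten_scalar G lam) x
    + schouten_scalar G lam x * f x * partial m f x)).
have c0 : 0 < 1 + f x ^+ 2 / 2.
  by rewrite ltr_wpDr // divr_ge0 ?sqr_ge0.
apply: (eigen_null_gradient (Gu Ux) (GT Ux) (orientation_sq Ux) Pu PG (N0 Ux) NN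
  (hessian_sym Uo GT fs Ux) (hessian_gradient Uo Gs GT Gu fs nul Ux) c0 (b := B)).
move=> K Ke i j k.
have We y p q : U y -> dual_eigen (- t y) (G y) (invmx (G y) *m weyl_mx G y p q *m invmx (G y)).
  by move=> Uy; apply: (weyl_eigen Uo Gs GT Gu fs sol); [|exact: Wo].
(* The indices are permuted so that the three cyclic terms appear in the order of [wedge3]. *)
have := soliton_three_form Uo Gs GT Gu fs ls sol nul smooth_orientation orientation_sq We
  j i k Ux Ke.
by rewrite /wedge3 (gradient_lower GT Gu f Ux) !mxE.
Qed.

Lemma chart_walker x : U x ->
  exists V : set 'rV[R]_4, [/\ open V, V x, V `<=` U & walker_on V G].
Proof.
move=> Ux; have [_ _ [K Ke Kneg]] := chart_null_plane Ux.
pose A := 2^-1 *: K.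
have AT : A^T = - A by have [KT _] := Ke; rewrite linearZ /= KT scalerN.
pose B y := A + t y *: (invmx (G y) *m dual4 A *m invmx (G y)).
have Be y : U y -> dual_eigen (t y) (G y) (B y).
  by move=> Uy; apply: eigen_proj; rewrite ?GT ?Gu ?orientation_sq.
have Bx : B x = K by apply: eigen_projK; rewrite ?Gu.
have Is := smooth_inv Uo Gu Gs.
have Bs : smooth_mx U B.
  apply: smooth_mxD => //; first exact: smooth_mx_cst.
  apply: smooth_mxZ => //; first exact: smooth_orientation.
  by apply: smooth_mxM => //; apply: smooth_mxM => //; exact: smooth_mx_cst.
clearbody B.
pose F y := \tr (G y *m B y *m G y *m B y).
have Fs : smooth_on U F.
  apply: (@smooth_trace _ _ Uo _ (fun y => G y *m B y *m G y *m B y)).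
  by do !apply: smooth_mxM => //.
(* On this open set the square of the extended section, which is the scalar [F y / 4], stays
   negative, so N and J N remain independent. *)
pose V := U `&` [set y | F y < 0].
have VU : V `<=` U by move=> y [].
have Vo : open V.
  rewrite openE => y [Uy Fy]; have A1 : nbhs y U by exact: open_nbhs_nbhs.
  have A2 : nbhs y (fun z => F z < 0).
    by have /cvgr_lt := smooth_continuous Fs Uy; apply.
  by apply: filterS2 A1 A2.
exists V; split => //; first by split=> //; rewrite /F /= Bx.
apply: (@walker_span R V Vo G _ _ _ f B).
- exact: smooth_mx_subset VU Gs.
- by move=> y /VU; exact: GT.
- by move=> y /VU; exact: Gu.
- exact: smooth_subset VU fs.
- exact: smooth_mx_subset VU Bs.
- by move=> y /VU Uy; have [] := Be y Uy.
- by move=> y /VU; exact: N0.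
- by move=> y /VU Uy; apply/matrixP => p q; rewrite !ord1 [RHS]mxE; exact: nul.
- by move=> y /VU; exact: (hessian_gradient Uo Gs GT Gu fs nul).
- by move=> y /VU Uy; have [H _ _] := chart_null_plane Uy; apply: H; exact: Be.
- move=> y [Uy Fy]; exists (4^-1 * F y); last exact: (eigen_sq (Be y Uy)).
  by rewrite pmulr_rlt0 // invr_gt0.
Qed.

End Chart.

Theorem theorem2 (R : realType) (M : manifold4 R) (g : pseudo_metric M)
    (f lam : M -> R) :
  neutral_signature g ->
  half_conformally_flat g ->
  smooth_fun f -> smooth_fun lam ->
  f_almost_ricci_soliton g f lam ->
  isotropic_gradient g f ->
  nowhere_zero_gradient g f ->
  locally_walker g /\
  (forall (c : chart M) (x : 'rV[R]_4), chart_img c x ->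
    in_chart c f x != 0 ->
    scalar_curvature (g c) x =
      4 * in_chart c lam x
      - 2 * (laplacian (g c) (in_chart c f) x / in_chart c f x)).
Proof.
move=> gn hcf fs ls sol nul N0.
(* Both claims are local, so it suffices to work on the neighbourhood, with its orientation,
   supplied by half conformal flatness. *)
have local c x : chart_img c x ->
    (exists V : set 'rV[R]_4, [/\ open V, V x, V `<=` chart_img c & walker_on V (g c)]) /\
    laplacian (g c) (in_chart c f) x = 0.
  move=> cx; have [V [s [Vo Vx Vc sd]]] := hcf c x cx.
  have [b Wb] : exists b : bool, forall y, V y -> forall w, two_form w ->
      (if b then weyl_plus s (g c) y w else weyl_minus s (g c) y w) = 0.
    by case: sd => sd; [exists false|exists true].
  have Gs : smooth_mx V (g c).
    by apply: smooth_mx_subset Vc _ => i j; exact: gram_smooth.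
  have GT y : V y -> (g c y)^T = g c y by move/Vc; exact: gram_sym.
  have Gu y : V y -> g c y \in unitmx by move/Vc; exact: gram_unit.
  have Gn y : V y -> exists2 P, P \in unitmx & P *m g c y *m P^T = eta4 by move/Vc/gn.
  have fV := smooth_subset Vc (fs c); have lV := smooth_subset Vc (ls c).
  have sV y : V y -> _ := fun Vy => sol c y (Vc y Vy).
  have nV y : V y -> _ := fun Vy => nul c y (Vc y Vy).
  have zV y : V y -> _ := fun Vy => N0 c y (Vc y Vy).
  split; last by have [] := chart_null_plane Vo Gs GT Gu Gn fV lV sV nV zV Wb Vx.
  have [V' [V'o V'x V'V W]] := chart_walker Vo Gs GT Gu Gn fV lV sV nV zV Wb Vx.
  by exists V'; split=> //; exact: subset_trans Vc.
split=> [c x /local[] //|c x cx _].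
have [_ L] := local c x cx; rewrite L mul0r mulr0 subr0.
have := congr1 (metric_trace (g c x)) (sol c x cx).
rewrite /metric_trace mulmxDr -!scalemxAr mxtraceD !mxtraceZ mulVmx ?gram_unit //.
rewrite -/(metric_trace _ (hessian _ _ _)) -/(laplacian _ _ _) L mulr0 addr0 mxtrace1 mulrC => <-.
by [].
Qed.
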